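(* Let $K\ge1$ be a real number. Let $(U_n)_{n\in\omega}$ be a Fraïssé sequence in the category $\mathfrak{RI}_K$, which is a chain of finite-dimensional rational $K$-based Banach spaces $(U_n,B_{U_n})$. Let $\mathbb U_K$ be the completion of the union $\bigcup_{n\in\omega}U_n$ and let $B_{\mathbb U_K}=\bigcup_{n\in\omega}B_{U_n}\subset\mathbb U_K$. Then the pair $(\mathbb U_K,B_{\mathbb U_K})$ is an $\mathfrak{RI}_K$-universal rational $K$-based Banach space.
   Context: All Banach spaces are separable and over $\mathbb R$. A normalized $K$-suppression basis of a Banach space $X$ is a subset $B\subset X$ for which there is a family $(e_b^* )_{b\in B}$ of continuous linear functionals on $X$ such that: $\|b\|=1=e_b^*(b)$ for all $b\in B$; $e_b^*(b')=0$ for distinct $b,b'\in B$; $x=\sum_{b\in B}e_b^*(x)\,b$ for every $x\in X$ (meaning that for every $\varepsilon>0$ there is a finite $F\subset B$ with $\|x-\sum_{b\in E}e_b^*(x)b\|<\varepsilon$ for every finite $E$ with $F\subset E\subset B$); and for every finite $F\subset B$ the projection $x\mapsto\sum_{b\in F}e_b^*(x)b$ has norm $\le K$. A $K$-based Banach space is a pair $(X,B_X)$ consisting of a Banach space $X$ and a normalized $K$-suppression basis $B_X$ of $X$ (the trivial space $\{0\}$ with empty basis is allowed). A based Banach space is a $K$-based Banach space for some $K\ge1$. A based Banach space $(X,B_X)$ is a (based) subspace of a based Banach space $(Y,B_Y)$ if $X\subseteq Y$ (a closed linear subspace with the restricted norm) and $B_X=X\cap B_Y$. An isometry morphism $(X,B_X)\to(Y,B_Y)$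 is a linear map $T:X\to Y$ with $T(B_X)\subseteq B_Y$ and $\|T(x)\|_Y=\|x\|_X$ for all $x\in X$. A finite-dimensional based Banach space $(X,B_X)$ is rational if its closed unit ball is the convex hull of finitely many vectors having rational coordinates in $B_X$. An arbitrary based Banach space is rational if each of its finite-dimensional based subspaces is rational. $\mathfrak{RI}_K$ is the category of rational finite-dimensional $K$-based Banach spaces and isometry morphisms between them. A chain is a sequence $(X_n)_{n\in\omega}$ of $K$-based Banach spaces such that each $X_n$ is a based subspace of $X_{n+1}$. A chain $(U_n)_{n\in\omega}$ of objects of $\mathfrak{RI}_K$ is a Fraïssé sequence if for any $n\in\omega$ and any $\mathfrak{RI}_K$-morphism $f:U_n\to Y$ there exist $m>n$ and an $\mathfrak{RI}_K$-morphism $g:Y\to U_m$ such that $g\circ f:U_n\to U_m$ is the identity inclusion. (By a general theorem of Kubiś, the category $\mathfrak{RI}_K$ has a Fraïssé sequence.) A based Banach space $X$ is $\mathfrak{RI}_K$-universal if for any rational finite-dimensional $K$-based Banach space $A$, any isometry morphism $f:\Lambda\to X$ defined on a based subspace $\Lambda$ of $A$ can be extended to an isometry morphism $\bar f:A\to X$. *)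

(* Defs.v *)
From HB Require Import structures.
From mathcomp Require Import all_boot all_order all_algebra finmap.
From mathcomp Require Import all_classical all_reals all_analysis.

Set Implicit Arguments.
Unset Strict Implicit.
Unset Printing Implicit Defensive.

Import Order.TTheory GRing.Theory Num.Theory.
Import numFieldNormedType.Exports.

Local Open Scope classical_set_scope.
Local Open Scope ring_scope.

(* A (based) Banach space is represented by a closed linear subspace [bspace]
   of some complete normed space [E] together with a subset [bbasis]; a Banach
   space on its own is the case [bspace = setT].  Thus "X is a subset of Y" is
   literal for two spaces inside the same [E], whereas morphisms may go between
   spaces inside different ambient types. *)
Record based_data (R : realType) (E : completeNormedModType R) := BasedData {
  bspace : set E ;
  bbasis : set E
}.

Definition separable_set (R : realType) (E : completeNormedModType R)
    (V : set E) : Prop :=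
  exists2 D : set E, countable D & D `<=` V /\ V `<=` closure D.

Definition is_banach (R : realType) (E : completeNormedModType R)
    (V : set E) : Prop :=
  [/\ submod_closed [in V], closed V & separable_set V].

Definition finite_dim (R : realType) (E : completeNormedModType R)
    (V : set E) : Prop :=
  exists S : {fset E},
    V = [set x | exists c : E -> R, x = \sum_(v <- S) c v *: v].

(* Maps on a subspace [V] are total functions on the ambient space whose values
   outside [V] are irrelevant. *)
Definition linear_on (R : realType) (E : lmodType R) (W : lmodType R)
    (V : set E) (T : E -> W) : Prop :=
  forall (a : R) (x y : E), V x -> V y -> T (a *: x + y) = a *: T x + T y.

Definition suppression_basis (R : realType) (K : R)
    (E : completeNormedModType R) (V B : set E) : Prop :=
  B `<=` V /\
  exists e : E -> E -> R^o,
    [/\ forall b, B b ->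
          linear_on V (e b) /\ {within V, continuous (e b)},
        forall b, B b -> `|b| = 1 /\ e b b = 1,
        forall b b', B b -> B b' -> b <> b' -> e b b' = 0,
        forall x, V x -> forall eps : R, 0 < eps ->
          exists F : {fset E}, [set` F] `<=` B /\
            forall G : {fset E}, (F `<=` G)%fset -> [set` G] `<=` B ->
              `|x - \sum_(b <- G) e b x *: b| < eps
      & forall F : {fset E}, [set` F] `<=` B ->
          forall x, V x -> `|\sum_(b <- F) e b x *: b| <= K * `|x| ].

Definition K_based (R : realType) (K : R) (E : completeNormedModType R)
    (X : based_data E) : Prop :=
  is_banach (bspace X) /\ suppression_basis K (bspace X) (bbasis X).

Definition based (R : realType) (E : completeNormedModType R)
    (X : based_data E) : Prop :=
  exists2 K : R, 1 <= K & K_based K X.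

(* Meant for [X] and [Y] that are based Banach spaces. *)
Definition based_subspace (R : realType) (E : completeNormedModType R)
    (X Y : based_data E) : Prop :=
  bspace X `<=` bspace Y /\ bbasis X = bspace X `&` bbasis Y.

Definition isometry_morphism (R : realType) (E F : completeNormedModType R)
    (X : based_data E) (Y : based_data F) (T : E -> F) : Prop :=
  [/\ linear_on (bspace X) T,
      forall x, bspace X x -> bspace Y (T x),
      forall b, bbasis X b -> bbasis Y (T b)
    & forall x, bspace X x -> `|T x| = `|x| ].

Definition rational_coordinates (R : realType) (E : completeNormedModType R)
    (B : set E) (v : E) : Prop :=
  exists (F : {fset E}) (q : E -> rat),
    [set` F] `<=` B /\ v = \sum_(b <- F) ratr (q b) *: b.

Definition convex_hull (R : realType) (E : completeNormedModType R)
    (A : set E) : set E :=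
  smallest (@convex_set R E) A.

Definition rational_fin (R : realType) (E : completeNormedModType R)
    (X : based_data E) : Prop :=
  finite_dim (bspace X) /\
  exists S : {fset E},
    (forall v, v \in S -> rational_coordinates (bbasis X) v) /\
    [set x | bspace X x /\ `|x| <= 1] = convex_hull [set` S].

Definition rational_based (R : realType) (E : completeNormedModType R)
    (X : based_data E) : Prop :=
  forall Z : based_data E, based Z -> based_subspace Z X ->
    finite_dim (bspace Z) -> rational_fin Z.

Definition RI_object (R : realType) (K : R) (E : completeNormedModType R)
    (X : based_data E) : Prop :=
  K_based K X /\ rational_fin X.

Definition based_chain (R : realType) (K : R) (E : completeNormedModType R)
    (U : nat -> based_data E) : Prop :=
  forall n, K_based K (U n) /\ based_subspace (U n) (U n.+1).

Definition fraisse_sequence (R : realType) (K : R)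
    (E : completeNormedModType R) (U : nat -> based_data E) : Prop :=
  [/\ based_chain K U,
      forall n, RI_object K (U n)
    & forall (n : nat) (F : completeNormedModType R) (Y : based_data F)
        (f : E -> F),
        RI_object K Y -> isometry_morphism (U n) Y f ->
        exists (m : nat) (g : F -> E),
          [/\ (n < m)%N, isometry_morphism Y (U m) g
            & forall x, bspace (U n) x -> g (f x) = x] ].

Definition RI_universal (R : realType) (K : R) (E : completeNormedModType R)
    (X : based_data E) : Prop :=
  forall (F : completeNormedModType R) (A L : based_data F) (f : F -> E),
    RI_object K A -> based L -> based_subspace L A ->
    isometry_morphism L X f ->
    exists fbar : F -> E,
      isometry_morphism A X fbar /\ forall x, bspace L x -> fbar x = f x.

(* The completion of an increasing union of subspaces of a complete space [E]
   is its closure in [E].  An abstract chain is covered by taking for [E] the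
   completion of its union. *)
Definition completed_union (R : realType) (E : completeNormedModType R)
    (U : nat -> based_data E) : based_data E :=
  BasedData (closure (\bigcup_n bspace (U n))) (\bigcup_n bbasis (U n)).

(* Main.v *)
Require Import Defs.
From HB Require Import structures.
From mathcomp Require Import all_boot all_order all_algebra finmap.
From mathcomp Require Import all_classical all_reals all_analysis.
From mathcomp Require Import ring.
Import Order.TTheory GRing.Theory Num.Theory.
Import numFieldNormedType.Exports.

Set Implicit Arguments.
Unset Strict Implicit.
Unset Printing Implicit Defensive.

Local Open Scope classical_set_scope.
Local Open Scope ring_scope.

(** The theorem has three independent parts.

    The completion is K-based. On the union [W] of the chain the coordinate
    functionals of the finite-dimensional spaces agree with each other, and
    each is bounded by [K], because it is a one-term suppression projection and
    basis vectors have norm 1. Bounded functionals extend to the closure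
    ([bounded_linear_extension]), the bound [K] on the projections passes to the
    closure by density, and the expansion of a limit point [x] converges because
    a point of [W] close to [x] is fixed by every projection whose support is
    large enough ([completion_suppression_basis]).

    The completion is rational. The finite basis of a finite-dimensional based
    subspace [Z] already lies in some [U n], so [Z] is a coordinate subspace of
    [U n] and its unit ball is a slice of a polytope with rational vertices by
    coordinate hyperplanes. Cutting a polytope by one hyperplane yields the hull
    of the vertices on the hyperplane and of the crossing points of the segments
    that join vertices on opposite sides ([convex_hull_slice]); crossing points
    of rational vertices are rational. Iterating over the missing coordinates
    gives [rational_fin_subspace].

    The completion is universal. An isometry morphism [f] from a subspace [L] of
    [A] takes the finite basis of [L], hence all of [L], into some [U n]. The
    category has amalgams: [A] and [U n] glued along [f] form an object [Y]
    ([amalgam_cospan]). The Fraisse property returns [Y] into the chain over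
    [U n], and the composite of [A -> Y] with this map extends [f].

    The amalgam is the space of real functions on the disjoint union of the
    basis of [U n] and of the basis vectors of [A] outside [L]. Its norm is the
    quotient of the sum norm, [inf (`|x1| + `|x2|)] over the decompositions of a
    vector into the images of [x1] in [A] and [x2] in [U n]. Then both maps into
    [Y] are isometries since [f] is one ([glue_norm1], [glue_norm2]), and a
    projection of [Y] is computed on the two parts separately, whence the same
    constant [K] ([glue_norm_restrict]). The unit ball of [Y] is the hull of the
    images of the two finite sets of vertices ([glue_ball]): the infimum only
    shows that the open ball lies in this hull, and the hull is closed because
    it is the image of a compact simplex ([convex_hull_closed]). *)

(** * Linear maps on subspaces and finite bases *)

Section Subspaces.
Variables (R : realType) (E W : lmodType R).
Implicit Types (V : set E) (T : E -> W).

Lemma submod_closedP V : submod_closed [in V] <->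
  V 0 /\ (forall (a : R) x y, V x -> V y -> V (a *: x + y)).
Proof.
split=> -[V0 Vl]; split.
- by move: V0; rewrite inE.
- by move=> a x y Vx Vy; have := Vl a x y; rewrite !inE; apply.
- by rewrite inE.
- by move=> a x y; rewrite !inE; exact: Vl.
Qed.

Section SubmodTheory.
Variables (V : set E) (Vs : submod_closed [in V]).

Lemma submod0 : V 0. Proof. by have [] := (submod_closedP V).1 Vs. Qed.

Lemma submodL (a : R) x y : V x -> V y -> V (a *: x + y).
Proof. by have [_] := (submod_closedP V).1 Vs; apply. Qed.

Lemma submodZ (a : R) x : V x -> V (a *: x).
Proof. by move=> Vx; rewrite -[_ *: x]addr0; apply: submodL => //; exact: submod0. Qed.

Lemma submodD x y : V x -> V y -> V (x + y).
Proof. by move=> Vx Vy; rewrite -[x]scale1r; exact: submodL. Qed.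

Lemma submodB x y : V x -> V y -> V (x - y).
Proof. by move=> Vx Vy; rewrite addrC -scaleN1r; exact: submodL. Qed.

Lemma submod_sum (I : eqType) (r : seq I) (P : pred I) (F : I -> E) :
  (forall i, i \in r -> P i -> V (F i)) -> V (\sum_(i <- r | P i) F i).
Proof.
move=> VF; rewrite big_seq_cond; apply: big_ind.
- exact: submod0.
- exact: submodD.
- by move=> i /andP[]; exact: VF.
Qed.

Variables (T : E -> W) (Tl : linear_on V T).

Lemma linear_on0 : T 0 = 0.
Proof.
have := Tl (-1) submod0 submod0.
by rewrite scaler0 add0r scaleN1r addNr.
Qed.

Lemma linear_onZ (a : R) x : V x -> T (a *: x) = a *: T x.
Proof.
move=> Vx; have := Tl a Vx submod0.
by rewrite addr0 linear_on0 addr0.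
Qed.

Lemma linear_onD x y : V x -> V y -> T (x + y) = T x + T y.
Proof. by move=> Vx Vy; have := Tl 1 Vx Vy; rewrite !scale1r. Qed.

Lemma linear_onB x y : V x -> V y -> T (x - y) = T x - T y.
Proof.
move=> Vx Vy; have := Tl (-1) Vy Vx.
by rewrite !scaleN1r addrC => ->; rewrite addrC.
Qed.

Lemma linear_on_sum (I : eqType) (r : seq I) (P : pred I) (c : I -> R)
    (F : I -> E) : (forall i, i \in r -> P i -> V (F i)) ->
  T (\sum_(i <- r | P i) c i *: F i) = \sum_(i <- r | P i) c i *: T (F i).
Proof.
move=> VF; rewrite big_seq_cond [RHS]big_seq_cond.
pose Q (x : E) (y : W) := V x /\ T x = y.
suff : Q (\sum_(i <- r | (i \in r) && P i) c i *: F i)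
         (\sum_(i <- r | (i \in r) && P i) c i *: T (F i)) by case.
apply: big_ind2.
- by split; [exact: submod0 | exact: linear_on0].
- move=> x1 x2 y1 y2 [V1 <-] [V2 <-].
  by split; [exact: submodD | exact: linear_onD].
- move=> i /andP[ir Pi].
  by split; [apply: submodZ; exact: VF | apply: linear_onZ; exact: VF].
Qed.

End SubmodTheory.

End Subspaces.

Section FinBasis.
Variable R : realType.

(** What a suppression basis amounts to when it is finite: summability becomes
    the exact expansion [fb_exp], and continuity of the coordinates is a
    consequence of [fb_supp]. The functionals [e] are kept as a parameter so
    that computations with coordinates can be carried out. *)
Record fin_basis (K : R) (E : completeNormedModType R) (V : set E)
    (B : {fset E}) (e : E -> E -> R^o) : Prop := FinBasis {
  fb_submod : submod_closed [in V] ;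
  fb_sub : forall b, b \in B -> V b ;
  fb_lin : forall b, b \in B -> linear_on V (e b) ;
  fb_norm : forall b, b \in B -> `|b| = 1 ;
  fb_kron : forall b b', b \in B -> b' \in B -> e b b' = (b == b')%:R ;
  fb_exp : forall x, V x -> x = \sum_(b <- B) e b x *: b ;
  fb_supp : forall F : {fset E}, (F `<=` B)%fset ->
    forall x, V x -> `|\sum_(b <- F) e b x *: b| <= K * `|x| }.

Variables (K : R) (E : completeNormedModType R).
Implicit Types (V : set E) (B : {fset E}).

(** The finite sets beyond which the partial sums are close to [x] can be
    enlarged to the whole basis, so the full sum is within every [eps] of [x]. *)
Lemma suppression_basis_fin V B : submod_closed [in V] ->
  suppression_basis K V [set` B] -> exists e, fin_basis K V B e.
Proof.
move=> Vs [BV [e [elin enorm ekron eexp esupp]]]; exists e; split => //.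
- by move=> b bB; have [] := elin b bB.
- by move=> b bB; have [] := enorm b bB.
- move=> b b' bB bB'; case: eqVneq => [<-|/eqP bb']; last exact: ekron.
  by have [] := enorm b bB.
- move=> x Vx; apply/eqP; rewrite -subr_eq0 -normr_le0; apply/ler_addgt0Pl.
  move=> eps eps0; rewrite addr0; have [F [FB HF]] := eexp x Vx eps eps0.
  by apply/ltW/HF => //; apply/fsubsetP => b bF; exact: FB.
- by move=> F /fsubsetP FB; exact: esupp.
Qed.

Section Theory.
Variables (V : set E) (B : {fset E}) (e : E -> E -> R^o).
Hypothesis Be : fin_basis K V B e.
Let Vs := fb_submod Be.

Lemma fb_comb (c : E -> R) : V (\sum_(b <- B) c b *: b).
Proof.
apply: submod_sum => // b bB _; apply: submodZ => //; exact: (fb_sub Be).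
Qed.

Lemma fb_coord_comb (F : {fset E}) (c : E -> R) b : (F `<=` B)%fset ->
  b \in B -> e b (\sum_(b' <- F) c b' *: b') = if b \in F then c b else 0.
Proof.
move=> /fsubsetP FB bB; rewrite (linear_on_sum Vs (fb_lin Be bB)); last first.
  by move=> i /FB iB _; exact: (fb_sub Be).
have [bF|bF] := boolP (b \in F).
  rewrite (big_fsetD1 b)//= (fb_kron Be)// eqxx scaler1 big_seq big1 ?addr0//.
  move=> b'; rewrite !inE => /andP[b'b /FB b'B].
  by rewrite (fb_kron Be)// eq_sym (negPf b'b) scaler0.
rewrite big_seq big1 // => b' b'F; rewrite (fb_kron Be)//; last exact: FB.
by case: eqVneq bF => [->|_ _]; rewrite ?b'F// scaler0.
Qed.

Lemma fb_coordP x y : V x -> V y -> (forall b, b \in B -> e b x = e b y) -> x = y.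
Proof.
move=> Vx Vy xy; rewrite (fb_exp Be Vx) (fb_exp Be Vy).
by rewrite big_seq [RHS]big_seq; apply: eq_bigr => b /xy ->.
Qed.

(** A coordinate is the length of a one-term projection, because basis vectors
    have norm 1. *)
Lemma fb_coord_le b x : b \in B -> V x -> `|e b x| <= K * `|x|.
Proof.
move=> bB Vx; have := fb_supp Be (F := [fset b]%fset) _ Vx.
rewrite big_seq_fset1 fsub1set => /(_ bB).
by rewrite normrZ (fb_norm Be bB) mulr1.
Qed.

(** Coordinates are unique, so the finite support and the rational coefficients
    in the definition of a rational vector can be read off from them. *)
Lemma fb_rational v : V v -> rational_coordinates [set` B] v <->
  forall b, b \in B -> exists q : rat, e b v = ratr q.
Proof.
move=> Vv; split=> [[F [q [FB ->]]] b bB|H].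
  rewrite fb_coord_comb//; last by apply/fsubsetP => c; exact: FB.
  by case: ifP => _; [exists (q b) | exists 0; rewrite raddf0].
have /choice[q Hq] : forall b, exists q : rat, b \in B -> e b v = ratr q.
  move=> b; have [bB|bB] := boolP (b \in B); last by exists 0.
  by have [q ?] := H b bB; exists q.
exists B, q; split => //; rewrite {1}(fb_exp Be Vv).
by rewrite big_seq [RHS]big_seq; apply: eq_bigr => b bB; rewrite Hq.
Qed.

End Theory.

(** Among more basis vectors than the size of a spanning set [S], biorthogonality
    would factor an identity matrix through a space of dimension [#|` S|]. *)
Lemma suppression_basis_finite V (B : set E) : submod_closed [in V] ->
  finite_dim V -> suppression_basis K V B -> finite_set B.
Proof.
move=> Vs [S VS] [BV [e [elin enorm ekron _ _]]].
apply: contrapT => /(infinite_set_fset (#|` S|.+1)) [F FB].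
rewrite ltnNge => /negP; apply.
have SV s : s \in S -> V s.
  move=> sS; rewrite VS /=; exists (fun v => (v == s)%:R).
  rewrite (big_fsetD1 s)//= eqxx scale1r big_seq big1 ?addr0// => v.
  by rewrite !inE => /andP[/negPf -> _]; rewrite scale0r.
have /choice[c Hc] : forall b, exists c : E -> R,
    V b -> b = \sum_(v <- S) c v *: v.
  move=> b; case: (pselect (V b)) => [|nV]; last by exists (fun=> 0).
  by rewrite {1}VS /= => -[c ->]; exists c.
set s := S : seq E; pose f := nth 0 F; pose g := nth 0 s.
have fF (i : 'I_#|` F|) : f i \in F.
  by rewrite -[_ \in F]/(_ \in enum_fset F) mem_nth.
(* rows: the basis vectors expanded over [S]; columns: their functionals on [S] *)
apply: (@mulmx1_min R #|` F| (size s)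
  (\matrix_(i, k) c (f i) (g k)) (\matrix_(k, j) (e (f j) (g k) : R))).
apply/matrixP => i j; rewrite !mxE.
under eq_bigr do rewrite !mxE.
have fB (k : 'I_#|` F|) : B (f k) by apply: FB => /=; exact: fF.
have : e (f j) (f i) = (i == j)%:R.
  case: eqVneq => [->|ij]; first by have [] := enorm (f j) (fB j).
  apply: ekron => //; apply/eqP; rewrite nth_uniq ?fset_uniq//.
  by rewrite eq_sym.
rewrite {1}(Hc (f i)); last exact: BV.
rewrite (linear_on_sum Vs (elin _ (fB j)).1); last by move=> v /SV.
by rewrite (big_nth 0) big_mkord.
Qed.

End FinBasis.

(** * Convex hulls of finite sets and their slices *)

Section ConvexHulls.
Variables (R : realType) (E : completeNormedModType R).
Implicit Types (A : set E) (S : {fset E}).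

Lemma convex_setP A : @convex_set R E A <->
  (forall x y (t : R), 0 <= t -> t <= 1 -> A x -> A y ->
    A (t *: x + (1 - t) *: y)).
Proof.
split=> [cA x y t t0 t1 Ax Ay|cA x y l].
  have t01 : Itv.spec (@Itv.num_sem R) (Itv.Real `[0%Z, 1%Z]) t.
    by rewrite /= /Itv.num_sem /= in_itv /= t0 t1 ger0_real.
  have := cA x y (Itv.mk t01); rewrite !inE => /(_ Ax Ay).
  by [].
rewrite !inE => Ax Ay.
by apply: cA.
Qed.

Lemma convex_hull_sub A : A `<=` convex_hull A.
Proof. exact: sub_smallest. Qed.

Lemma convex_hull_min A C : @convex_set R E C -> A `<=` C -> convex_hull A `<=` C.
Proof. by move=> cC AC; exact: smallest_sub. Qed.

Lemma convex_hull_convex A : @convex_set R E (convex_hull A).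
Proof.
move=> x y t; rewrite !inE => Hx Hy C [cC AC].
have := cC x y t; rewrite !inE; apply; [exact: Hx | exact: Hy].
Qed.

(** Weights and points come as one list, so that combinations indexed by
    different sets can be concatenated; a point of weight 0 need not lie in
    [A]. *)
Lemma convex_comb A (r : seq (R * E)) : @convex_set R E A ->
  (forall z, z \in r -> 0 <= z.1) -> (forall z, z \in r -> z.1 != 0 -> A z.2) ->
  \sum_(z <- r) z.1 = 1 -> A (\sum_(z <- r) z.1 *: z.2).
Proof.
move=> /convex_setP cA r0 rA r1.
(* For the induction on the list the weights are renormalised: the tail of a
   convex combination is a convex combination only up to a factor. *)
suff H : 0 < \sum_(z <- r) z.1 ->
    A ((\sum_(z <- r) z.1)^-1 *: \sum_(z <- r) z.1 *: z.2).
  by move: H; rewrite r1 invr1 scale1r; apply.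
elim: r r0 rA {r1} => [_ _|[w p] r IH r0 rA].
  by rewrite big_nil ltxx.
have w0 : 0 <= w by apply: (r0 (w, p)); rewrite mem_head.
have r0' z : z \in r -> 0 <= z.1 by move=> zr; apply: r0; rewrite inE zr orbT.
have rA' z : z \in r -> z.1 != 0 -> A z.2.
  by move=> zr; apply: rA; rewrite inE zr orbT.
rewrite !big_cons /=.
have : 0 <= \sum_(z <- r) z.1 by rewrite big_seq; apply: sumr_ge0.
rewrite le_eqVlt => /predU1P[/esym W0|Wgt0].
  rewrite W0 addr0 => wgt0.
  rewrite [X in _ + X]big_seq big1 ?addr0; last first.
    move=> z zr; move/eqP: W0; rewrite big_seq psumr_eq0//.
    by move=> /allP /(_ _ zr); rewrite zr/= => /eqP ->; rewrite scale0r.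
  rewrite scalerA mulVf ?gt_eqF// scale1r.
  by apply: (rA (w, p)); rewrite ?mem_head ?gt_eqF.
have {}IH := IH r0' rA' Wgt0; set W := \sum_(z <- r) z.1 in Wgt0 IH *.
move: w0; rewrite le_eqVlt => /predU1P[<-|wgt0] wW.
  by rewrite add0r scale0r add0r.
set y := _ *: _ in IH.
have -> : \sum_(z <- r) z.1 *: z.2 = W *: y.
  by rewrite /y scalerA divff ?scale1r ?gt_eqF.
move: y IH => y IH; rewrite scalerDr !scalerA.
have -> : (w + W)^-1 * W = 1 - (w + W)^-1 * w.
  have : w + W != 0 by rewrite gt_eqF.
  by move=> ?; field.
apply: cA => //.
- by rewrite mulr_ge0 ?invr_ge0 ?ltW.
- by rewrite mulrC ler_pdivrMr// mul1r lerDl ltW.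
- by apply: (rA (w, p)); rewrite ?mem_head ?gt_eqF.
Qed.

Lemma convex_hull_fsetP S x : convex_hull [set` S] x <->
  exists l : E -> R, [/\ forall s, s \in S -> 0 <= l s,
    \sum_(s <- S) l s = 1 & x = \sum_(s <- S) l s *: s].
Proof.
split=> [|[l [l0 l1 ->]]].
  pose C := [set x | exists l : E -> R, [/\ forall s, s \in S -> 0 <= l s,
    \sum_(s <- S) l s = 1 & x = \sum_(s <- S) l s *: s]].
  apply: (convex_hull_min (C := C)) => {x}.
    apply/convex_setP => x y t t0 t1 [l [l0 l1 ->]] [m [m0 m1 ->]].
    exists (fun s => t * l s + (1 - t) * m s); split.
    - by move=> s sS; rewrite addr_ge0// mulr_ge0 ?subr_ge0 ?l0 ?m0.
    - by rewrite big_split/= -!mulr_sumr l1 m1 !mulr1 addrC subrK.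
    - rewrite !scaler_sumr -big_split; apply: eq_bigr => s _ /=.
      by rewrite [RHS]scalerDl !scalerA.
  move=> s /= sS; exists (fun v => (v == s)%:R); split.
  - by move=> v _; rewrite ler0n.
  - rewrite (big_fsetD1 s)//= eqxx big_seq big1 ?addr0// => v.
    by rewrite !inE => /andP[/negPf -> _].
  - rewrite (big_fsetD1 s)//= eqxx scale1r big_seq big1 ?addr0// => v.
    by rewrite !inE => /andP[/negPf -> _]; rewrite scale0r.
have -> : \sum_(s <- S) l s *: s =
    \sum_(z <- [seq (l s, s) | s <- S]) z.1 *: z.2 by rewrite big_map.
apply: convex_comb.
- exact: convex_hull_convex.
- by move=> _ /mapP[s sS ->]; exact: l0.
- by move=> _ /mapP[s sS ->] _; exact: convex_hull_sub.
- by rewrite big_map.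
Qed.

(** For [phi s > 0 > phi t], the point of the segment from [s] to [t] at which
    [phi], if it is linear, vanishes. *)
Definition crossing (phi : E -> R) (s t : E) : E :=
  (phi s - phi t)^-1 *: (phi s *: t - phi t *: s).

(** The vertices on the hyperplane [phi = 0], and the points where the segments
    between vertices on its two sides meet it. *)
Definition slice (phi : E -> R) S : {fset E} :=
  ([fset s in S | phi s == 0%R] `|`
   [fset z in [seq crossing phi s t | s <- [seq s <- S | (0 < phi s)%R],
                                      t <- [seq t <- S | (phi t < 0)%R]]])%fset.

Lemma sliceP (phi : E -> R) S v : v \in slice phi S ->
  (v \in S /\ phi v = 0) \/
  exists s t, [/\ s \in S, t \in S, 0 < phi s, phi t < 0 & v = crossing phi s t].
Proof.
rewrite in_fsetU => /orP[|]; first by rewrite !inE => /andP[vS /eqP]; left.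
rewrite in_fset => /allpairsP[[s t] /= []]; rewrite !mem_filter.
by move=> /andP[s0 sS] /andP[t0 tS] ->; right; exists s, t.
Qed.

Lemma crossing_convex (phi : E -> R) s t : 0 < phi s -> phi t < 0 ->
  exists2 u : R, 0 <= u <= 1 & crossing phi s t = u *: s + (1 - u) *: t.
Proof.
move=> s0 t0.
have st : 0 < phi s - phi t by rewrite subr_gt0 (lt_trans t0).
exists (- phi t / (phi s - phi t)).
  apply/andP; split; first by rewrite divr_ge0 ?oppr_ge0 ?ltW.
  by rewrite ler_pdivrMr// mul1r lerDr ltW.
rewrite /crossing scalerBr !scalerA addrC.
have -> : 1 - - phi t / (phi s - phi t) = (phi s - phi t)^-1 * phi s.
  by field; rewrite gt_eqF.
by rewrite -scaleNr mulNr mulrC.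
Qed.

Lemma crossing0 (V : set E) (phi : E -> R^o) s t :
  submod_closed [in V] -> linear_on V phi -> V s -> V t ->
  V (crossing phi s t) /\ phi (crossing phi s t) = 0.
Proof.
move=> Vs phil Ps Pt; have Zs := submodZ Vs (phi t) Ps.
have Zt := submodZ Vs (phi s) Pt; have Zst := submodB Vs Zt Zs.
split; first exact: submodZ.
rewrite (linear_onZ Vs phil)// (linear_onB phil)// !(linear_onZ Vs phil)//.
by rewrite /GRing.scale/= [phi t * _]mulrC subrr mulr0.
Qed.

Lemma sum_sign (phi : E -> R) (W : zmodType) (F : E -> W) S :
  \sum_(s <- S) F s = \sum_(s <- S | phi s == 0) F s +
    (\sum_(s <- S | 0 < phi s) F s + \sum_(s <- S | phi s < 0) F s).
Proof.
rewrite (bigID (fun s => phi s == 0))/=; congr (_ + _).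
rewrite (bigID (fun s => 0 < phi s))/=; congr (_ + _); apply: eq_bigl => s.
  by case: ltgtP.
by case: ltgtP.
Qed.

(** One step of the double description method. In a convex combination [x] with
    [phi x = 0] the positive part [M] of the sum of the [l s * phi s] balances the
    negative part. Each positive [s] can therefore be paired with all negative
    [t], and the crossing of [s] and [t], taken with weight
    [l s * l t * (phi s - phi t) / M], accounts for a share of both vertices: over
    all pairs these shares add up to the weights [l s] and [l t]. *)
Lemma convex_hull_slice (V : set E) (phi : E -> R^o) S :
  submod_closed [in V] -> linear_on V phi -> (forall s, s \in S -> V s) ->
  convex_hull [set` S] `&` [set x | phi x = 0] = convex_hull [set` slice phi S].
Proof.
move=> Vs phil SV; apply/seteqP; split=> x; last first.
  pose C := convex_hull [set` S] `&` [set x | V x /\ phi x = 0].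
  suff : convex_hull [set` slice phi S] `<=` C.
    by move=> /[apply] -[Sx [_ x0]]; split.
  apply: convex_hull_min.
    apply/convex_setP => {}x y t t0 t1 [Sx [Vx x0]] [Sy [Vy y0]]; split.
      by move/convex_setP: (@convex_hull_convex [set` S]); apply.
    split; first by apply: submodD => //; exact: submodZ.
    rewrite (linear_onD phil)//; try exact: submodZ.
    by rewrite !(linear_onZ Vs phil)// x0 y0 !scaler0 addr0.
  move=> v /= /sliceP[[vS v0]|[s [t [sS tS s0 t0 ->]]]].
    by split; [exact: convex_hull_sub | split; [exact: SV|]].
  split; last by apply: crossing0 => //; exact: SV.
  have [u /andP[u0 u1] ->] := crossing_convex s0 t0.
  by move/convex_setP: (@convex_hull_convex [set` S]); apply => //;
    exact: convex_hull_sub.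
move=> [/convex_hull_fsetP[l [l0 l1 xE]] /= x0].
have sub0 s : s \in S -> phi s == 0 -> convex_hull [set` slice phi S] s.
  move=> sS s0; apply: convex_hull_sub => /=.
  by rewrite in_fsetU !inE sS s0.
have subC s t : s \in S -> t \in S -> 0 < phi s -> phi t < 0 ->
    crossing phi s t \in slice phi S.
  move=> sS tS s0 t0; rewrite in_fsetU; apply/orP; right; rewrite in_fset.
  by apply/allpairsP; exists (s, t); rewrite !mem_filter s0 t0.
pose Sp := [seq s <- S | 0 < phi s]; pose Sn := [seq s <- S | phi s < 0].
pose r0 := [seq (l s, s) | s <- S & phi s == 0].
pose M := \sum_(s <- Sp) l s * phi s.
have M0 : 0 <= M.
  rewrite /M big_filter big_seq_cond sumr_ge0// => s /andP[sS s0].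
  by rewrite mulr_ge0 ?l0 ?ltW.
have Mn : \sum_(s <- Sn) l s * phi s = - M.
  move: x0; rewrite xE (linear_on_sum Vs phil); last by move=> s /SV.
  rewrite (sum_sign phi) big1 ?add0r => [|s /eqP ->]; last by rewrite scaler0.
  by rewrite /M !big_filter addrC => /eqP; rewrite addr_eq0 => /eqP.
pose r1 := [seq (l s * l t * (phi s - phi t) / M, crossing phi s t) | s <- Sp, t <- Sn].
have [W1 W2] : \sum_(z <- r1) z.1 = \sum_(s <- Sp) l s + \sum_(s <- Sn) l s /\
   \sum_(z <- r1) z.1 *: z.2 = \sum_(s <- Sp) l s *: s + \sum_(s <- Sn) l s *: s.
  (* If [M] is 0, all vertices off the hyperplane have weight 0, and so have the
     pairs, since the quotient by [M] is then 0. *)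
  rewrite !big_allpairs_dep/=.
  move: M0; rewrite le_eqVlt => /predU1P[/esym M0|Mgt0].
    have lp0 s : s \in Sp -> l s = 0.
      rewrite mem_filter => /andP[s0 sS]; move/eqP: M0.
      rewrite /M big_filter big_seq_cond psumr_eq0; last first.
        by move=> i /andP[iS i0]; rewrite mulr_ge0 ?l0 ?ltW.
      move=> /allP /(_ _ sS); rewrite sS s0/= mulf_eq0 (gt_eqF s0) orbF.
      by move/eqP.
    have ln0 s : s \in Sn -> l s = 0.
      rewrite mem_filter => /andP[s0 sS]; move/eqP: Mn.
      rewrite M0 oppr0 -oppr_eq0 big_filter -sumrN big_seq_cond psumr_eq0; last first.
        by move=> i /andP[iS i0]; rewrite -mulrN mulr_ge0 ?l0 ?oppr_ge0 ?ltW.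
      move=> /allP /(_ _ sS); rewrite sS s0/= oppr_eq0 mulf_eq0 (lt_eqF s0) orbF.
      by move/eqP.
    rewrite M0 invr0; split.
      rewrite [X in _ = X + _]big_seq [X in _ = _ + X]big_seq !big1 ?addr0//.
      by move=> s _; rewrite big1// => t _; rewrite mulr0.
    rewrite [X in _ = X + _]big_seq [X in _ = _ + X]big_seq !big1 ?addr0//.
    - by move=> s /ln0 ->; rewrite scale0r.
    - by move=> s /lp0 ->; rewrite scale0r.
    - by move=> s _; rewrite big1// => t _; rewrite mulr0 scale0r.
  have Mneq0 : M != 0 by rewrite gt_eqF.
  split.
    transitivity (M^-1 * ((\sum_(s <- Sp) l s * phi s) * (\sum_(s <- Sn) l s) -
        (\sum_(s <- Sp) l s) * (\sum_(s <- Sn) l s * phi s))).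
      rewrite !big_distrlr/= -sumrB mulr_sumr; apply: eq_bigr => s _.
      by rewrite -sumrB mulr_sumr; apply: eq_bigr => t _; field.
    by rewrite Mn -/M; field.
  transitivity (M^-1 *: ((\sum_(s <- Sp) l s * phi s) *: (\sum_(s <- Sn) l s *: s) -
      (\sum_(s <- Sn) l s * phi s) *: (\sum_(s <- Sp) l s *: s))).
    rewrite scaler_suml scaler_sumr -sumrB scaler_sumr big_seq [RHS]big_seq.
    apply: eq_bigr => s; rewrite mem_filter => /andP[s0 _].
    rewrite scaler_suml scaler_sumr -sumrB scaler_sumr big_seq [RHS]big_seq.
    apply: eq_bigr => t; rewrite mem_filter => /andP[t0 _].
    have st : phi s - phi t != 0 by rewrite gt_eqF// subr_gt0 (lt_trans t0).
    rewrite /crossing !scalerBr !scalerA; congr (_ *: _ - _ *: _); field;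
      by rewrite st Mneq0.
  rewrite Mn -/M scaleNr opprK scalerDr !scalerA mulVf// !scale1r.
  by rewrite addrC.
have -> : x = \sum_(z <- r0 ++ r1) z.1 *: z.2.
  by rewrite xE (sum_sign phi) big_cat W2 /r0 big_map !big_filter.
apply: convex_comb.
- exact: convex_hull_convex.
- move=> z; rewrite mem_cat => /orP[/mapP[s]|/allpairsP[[s t] /= [+ + ->/=]]].
    by rewrite mem_filter => /andP[_ sS] -> /=; exact: l0.
  rewrite !mem_filter => /andP[s0 sS] /andP[t0 tS].
  by rewrite divr_ge0// !mulr_ge0 ?l0// subr_ge0 ltW// (lt_trans t0).
- move=> z; rewrite mem_cat => /orP[/mapP[s]|/allpairsP[[s t] /= [+ + ->/=]]].
    by rewrite mem_filter => /andP[s0 sS] -> _ /=; exact: sub0.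
  rewrite !mem_filter => /andP[s0 sS] /andP[t0 tS] _.
  by apply: convex_hull_sub => /=; exact: subC.
- by rewrite big_cat/= W1 /r0 big_map !big_filter -(sum_sign phi).
Qed.

End ConvexHulls.

(** * Subspaces of rational spaces *)

Section RationalSubspaces.
Variables (R : realType) (K : R) (E : completeNormedModType R).
Variables (V : set E) (B : {fset E}) (e : E -> E -> R^o).
Hypothesis Be : fin_basis K V B e.
Let Vs := fb_submod Be.

Lemma crossing_rational b c s t : b \in B -> c \in B -> V s -> V t ->
  (forall b, b \in B -> exists q : rat, e b s = ratr q) ->
  (forall b, b \in B -> exists q : rat, e b t = ratr q) ->
  exists q : rat, e c (crossing (e b) s t) = ratr q.
Proof.
move=> bB cB Ps Pt qs qt; have lc := fb_lin Be cB.
have Zs := submodZ Vs (e b t) Ps; have Zt := submodZ Vs (e b s) Pt.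
rewrite /crossing (linear_onZ Vs lc); last exact: submodB.
rewrite (linear_onB lc)// !(linear_onZ Vs lc)//.
have [q1 ->] := qs b bB; have [q2 ->] := qt b bB.
have [q3 ->] := qs c cB; have [q4 ->] := qt c cB.
exists ((q1 - q2)^-1 * (q1 * q4 - q2 * q3)).
by rewrite /GRing.scale/= rmorphM fmorphV !rmorphB !rmorphM.
Qed.

(** The list [r] collects the coordinates that are already set to 0. *)
Lemma rational_slices (S : {fset E}) (r : seq E) :
  (forall s, s \in S -> V s /\ forall b, b \in B -> exists q : rat, e b s = ratr q) ->
  [set x | V x /\ `|x| <= 1] = convex_hull [set` S] ->
  {subset r <= B} ->
  exists S' : {fset E},
    (forall s, s \in S' -> [/\ V s,
        forall b, b \in B -> exists q : rat, e b s = ratr q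
      & forall b, b \in r -> e b s = 0]) /\
    [set x | [/\ V x, `|x| <= 1 & forall b, b \in r -> e b x = 0]] =
      convex_hull [set` S'].
Proof.
move=> SQ SV; elim: r => [_|b r IH brB].
  exists S; split; first by move=> s /SQ[].
  by rewrite -SV; apply/seteqP; split=> x /= [].
have bB : b \in B by apply: brB; rewrite mem_head.
have rB : {subset r <= B} by move=> c cr; apply: brB; rewrite inE cr orbT.
have [S' [S'Q S'V]] := IH rB.
have S'P s : s \in S' -> V s by move=> /S'Q[].
exists (slice (e b) S'); split.
  move=> v /sliceP[[vS v0]|[s [t [sS tS _ _ ->]]]].
    have [Vv Qv v0'] := S'Q v vS; split => // c; rewrite inE.
    by move=> /predU1P[->|]//; exact: v0'.
  have [[Vst Qs s0] [Vt Qt t0]] := (S'Q _ sS, S'Q _ tS).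
  have [Vc c0] := crossing0 Vs (fb_lin Be bB) Vst Vt.
  split => // [c cB|c]; first exact: crossing_rational.
  rewrite inE => /predU1P[->//|cr]; have lc := fb_lin Be (rB _ cr).
  have Zs := submodZ Vs (e b t) Vst; have Zt := submodZ Vs (e b s) Vt.
  rewrite /crossing (linear_onZ Vs lc); last exact: submodB.
  rewrite (linear_onB lc)//.
  by rewrite !(linear_onZ Vs lc)// (s0 c cr) (t0 c cr) !scaler0 subrr scaler0.
rewrite -(convex_hull_slice Vs (fb_lin Be bB) S'P) -S'V.
apply/seteqP; split=> x /=.
  move=> [Vx x1 x0]; split; last by apply: x0; rewrite mem_head.
  by split=> // c cr; apply: x0; rewrite inE cr orbT.
by move=> [[Vx x1 x0] xb]; split=> // c; rewrite inE => /predU1P[->//|]; exact: x0.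
Qed.

(** A subspace spanned by part of the basis is cut out by the remaining
    coordinates. *)
Lemma coordinate_subspace (K' : R) (Z : set E) (C : {fset E}) (e' : E -> E -> R^o) :
  fin_basis K' Z C e' -> Z `<=` V -> (C `<=` B)%fset ->
  Z = [set x | V x /\ forall b, b \in B -> b \notin C -> e b x = 0].
Proof.
move=> Ce ZV CB; have CBs := fsubsetP CB; apply/seteqP; split=> x /=.
  move=> Zx; split; first exact: ZV.
  move=> b bB bC; rewrite (fb_exp Ce Zx) (fb_coord_comb Be)//.
  by rewrite (negPf bC).
move=> [Vx x0]; suff -> : x = \sum_(b <- C) e b x *: b by exact: (fb_comb Ce).
apply: (fb_coordP Be) => //.
  by apply: submod_sum => // b /CBs bB _; apply: submodZ => //; exact: (fb_sub Be).
move=> b bB; rewrite (fb_coord_comb Be)//.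
by case: ifPn => //; exact: x0.
Qed.

End RationalSubspaces.

Section RationalFin.
Variables (R : realType) (E : completeNormedModType R).

Lemma rational_fin_coords (K : R) (V : set E) (B : {fset E}) (e : E -> E -> R^o) :
  fin_basis K V B e ->
  rational_fin (BasedData V [set` B]) ->
  exists S : {fset E},
    (forall s, s \in S -> V s /\ forall b, b \in B -> exists q : rat, e b s = ratr q) /\
    [set x | V x /\ `|x| <= 1] = convex_hull [set` S].
Proof.
move=> Be [_ [S [Sr SV]]]; exists S; split=> // s sS.
have Vs : V s.
  by have : convex_hull [set` S] s by [exact: convex_hull_sub]; rewrite -SV => -[].
by split=> //; apply/(fb_rational Be Vs); exact: Sr.
Qed.

Lemma fin_basis_finite_dim (K : R) (V : set E) (B : {fset E})
    (e : E -> E -> R^o) : fin_basis K V B e -> finite_dim V.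
Proof.
move=> Be; exists B; apply/seteqP; split=> x /=.
  by move=> Vx; exists (fun b => e b x); exact: (fb_exp Be).
by move=> [c ->]; exact: (fb_comb Be).
Qed.

(** The unit ball of the coordinate subspace [Z] is the slice of the unit ball of
    [V] by the hyperplanes of the coordinates outside [C]. A projection of [V]
    onto [Z] would not do: it may have norm [K] and need not map the ball into
    itself. *)
Lemma rational_fin_subspace (K K' : R) (V Z : set E) (B C : {fset E})
    (e e' : E -> E -> R^o) : fin_basis K V B e ->
  rational_fin (BasedData V [set` B]) ->
  fin_basis K' Z C e' -> Z `<=` V -> (C `<=` B)%fset ->
  rational_fin (BasedData Z [set` C]).
Proof.
move=> Be Vrat Ce ZV CB; split.
  exact: fin_basis_finite_dim Ce.
have [S [SQ SV]] := rational_fin_coords Be Vrat.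
have DB : {subset (B `\` C)%fset <= B} by move=> b; rewrite inE => /andP[].
have [S' [S'Q S'V]] := rational_slices Be SQ SV DB.
have ZE := coordinate_subspace Be Ce ZV CB.
have ZP x : Z x <-> V x /\ forall b, b \in (B `\` C)%fset -> e b x = 0.
  rewrite ZE /=; split=> -[Vx H]; split=> // b.
    by rewrite inE => /andP[bC bB]; exact: H.
  by move=> bB bC; apply: H; rewrite inE bC.
exists S'; split=> /=.
  move=> v /S'Q[Vv Qv v0]; apply/(fb_rational Ce); first by apply/ZP.
  have Zv : Z v by apply/ZP.
  move=> c cC; have cB := fsubsetP CB _ cC.
  suff <- : e c v = e' c v by exact: Qv.
  by rewrite {1}(fb_exp Ce Zv) (fb_coord_comb Be)// cC.
rewrite -S'V; apply/seteqP; split=> x /=.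
  by move=> [/ZP[Vx x0] x1].
by move=> [Vx x1 x0]; split=> //; apply/ZP.
Qed.

End RationalFin.

(** * Closures of subspaces and extension of functionals *)

Section Closures.
Variables (R : realType) (E : completeNormedModType R).
Implicit Types (W V : set E).

Lemma closure_normP W x :
  closure W x <-> forall eps : R, 0 < eps -> exists2 w, W w & `|x - w| < eps.
Proof.
split=> [Wx eps eps0|H A /nbhs_ballP[eps /= eps0 HA]].
  have [w [Ww]] := Wx (ball x eps) (nbhsx_ballx x eps eps0).
  by rewrite -ball_normE /= => xw; exists w.
have [w Ww xw] := H eps eps0.
by exists w; split=> //; apply: HA; rewrite -ball_normE.
Qed.

Lemma closure_submod W : submod_closed [in W] -> submod_closed [in closure W].
Proof.
move=> Ws; apply/submod_closedP; split.
  by apply: subset_closure; exact: submod0.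
move=> a x y /closure_normP Wx /closure_normP Wy; apply/closure_normP => eps eps0.
have a0 : 0 < `|a| + 1 by rewrite ltr_wpDl.
have e2 : 0 < eps / 2 by rewrite divr_gt0.
have [w Ww xw] := Wx (eps / 2 / (`|a| + 1)) (divr_gt0 e2 a0).
have [v Wv yv] := Wy (eps / 2) e2.
exists (a *: w + v); first exact: submodL.
rewrite opprD addrACA -scalerBr [ltRHS]splitr.
apply: le_lt_trans (ler_normD _ _) _; apply: ler_ltD => //.
move: xw; rewrite normrZ ltr_pdivlMr// mulrC => /ltW; apply: le_trans.
by rewrite ler_wpM2r // lerDl.
Qed.

Lemma bounded_linear_continuous V (C : R) (h : E -> R^o) :
  submod_closed [in V] -> linear_on V h -> (forall x, V x -> `|h x| <= C * `|x|) ->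
  {within V, continuous h}.
Proof.
move=> Vs hl hC; apply/subspace_continuousP => x Vx; apply/cvgrPdist_le => eps eps0.
rewrite near_withinE; apply/nbhs_ballP.
have C0 : 0 < `|C| + 1 by rewrite ltr_wpDl.
exists (eps / (`|C| + 1)); first by rewrite /= divr_gt0.
move=> y; rewrite -ball_normE /= => /ltW xy Vy.
rewrite -(linear_onB hl)// (le_trans (hC _ (submodB Vs Vx Vy)))//.
move: xy; rewrite ler_pdivlMr// mulrC; apply: le_trans.
by rewrite ler_wpM2r// (le_trans (ler_norm C))// lerDl.
Qed.

(** The supremum of [g w - C * `|x - w|] over [w] in [W] is McShane's extension of
    a Lipschitz function. It need not be linear off the closure of [W]; on the
    closure it is determined by the values of [g], and linearity passes to the
    limit. *)
Lemma bounded_linear_extension W (C : R) (g : E -> R^o) :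
  submod_closed [in W] -> 0 <= C -> linear_on W g ->
  (forall w, W w -> `|g w| <= C * `|w|) ->
  exists h : E -> R^o, [/\ linear_on (closure W) h,
    forall w, W w -> h w = g w & forall x, `|h x| <= C * `|x| ].
Proof.
move=> Ws C0 gl gC.
have lipW w v : W w -> W v -> g w - g v <= C * `|w - v|.
  move=> Ww Wv; rewrite -(linear_onB gl)//.
  by apply: le_trans (ler_norm _) _; apply: gC; exact: submodB.
have /choice[h hP] : forall x, exists c : R^o, forall w, W w -> `|c - g w| <= C * `|x - w|.
  move=> x; pose S := [set g w - C * `|x - w| | w in W].
  have ubS w : W w -> ubound S (g w + C * `|x - w|).
    move=> Ww _ [v Wv <-]; rewrite lerBlDr -addrA -lerBlDl.
    apply: le_trans (lipW _ _ Wv Ww) _; rewrite -mulrDr ler_wpM2l//.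
    by rewrite [leRHS]addrC -(distrC v x) (le_trans _ (ler_normD _ _))// subrKA.
  have W0 := submod0 Ws.
  have Ssup : has_sup S.
    split; first by exists (g 0 - C * `|x - 0|), 0.
    by exists (g 0 + C * `|x - 0|); exact: ubS.
  exists (sup S) => w Ww; rewrite ler_distl; apply/andP; split.
    by apply: sup_upper_bound => //; exists w.
  by apply: ge_sup; [case: Ssup | exact: ubS].
have hW w : W w -> h w = g w.
  move=> Ww; apply/eqP; rewrite -subr_eq0 -normr_le0.
  by rewrite (le_trans (hP w w Ww))// subrr normr0 mulr0.
exists h; split=> //; last first.
  move=> x; have := hP x 0 (submod0 Ws).
  by rewrite (linear_on0 Ws gl) !subr0.
move=> a x y /closure_normP Wx /closure_normP Wy.
apply/eqP; rewrite -subr_eq0 -normr_le0; apply/ler_addgt0Pl => eps eps0.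
rewrite addr0; pose D := 2 * C * (`|a| + 1) + 1.
(* With [x] and [y] approximated up to [eps / D], the three errors add up to at
   most [2 * C * (`|a| + 1) * (eps / D)]. *)
have D0 : 0 < D by rewrite ltr_wpDl// !mulr_ge0// addr_ge0.
have [w Ww xw] := Wx (eps / D) (divr_gt0 eps0 D0).
have [v Wv yv] := Wy (eps / D) (divr_gt0 eps0 D0).
have /(hP (a *: x + y)) := submodL Ws a Ww Wv.
rewrite gl// => H1; have H2 := hP x w Ww; have H3 := hP y v Wv.
have -> : h (a *: x + y) - (a *: h x + h y) =
  (h (a *: x + y) - (a *: g w + g v)) - a *: (h x - g w) - (h y - g v).
  by rewrite scalerBr; ring.
set d := eps / D in xw yv.
have H4 : `|a *: x + y - (a *: w + v)| <= `|a| * d + d.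
  rewrite opprD addrACA -scalerBr (le_trans (ler_normD _ _))// lerD ?(ltW yv)//.
  by rewrite normrZ ler_wpM2l// ltW.
have -> : eps = C * (`|a| * d + d) + `|a| * (C * d) + C * d + d.
  by rewrite /d /D; field; rewrite gt_eqF.
apply: le_trans (ler_normB _ _) _; rewrite -[leRHS]addrA; apply: lerD; last first.
  by rewrite (le_trans H3)// ler_wpDr ?ler_wpM2l// ltW// divr_gt0.
apply: le_trans (ler_normB _ _) _; apply: lerD.
  by rewrite (le_trans H1)// ler_wpM2l.
rewrite normrZ ler_wpM2l// (le_trans H2)// ler_wpM2l//; exact: ltW.
Qed.

End Closures.

(** * The completion of a chain *)

Section Completion.
Variables (R : realType) (K : R) (E : completeNormedModType R).
Variables (V : nat -> set E) (B : nat -> {fset E}) (e : nat -> E -> E -> R^o).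
Hypothesis K0 : 0 <= K.
Hypothesis Be : forall n, fin_basis K (V n) (B n) (e n).
Hypothesis VS : forall n, V n `<=` V n.+1.
Hypothesis BS : forall n, (B n `<=` B n.+1)%fset.

Local Notation W := (\bigcup_n V n).
Local Notation Binf := (\bigcup_n [set` B n]).

Lemma chain_space m n : (m <= n)%N -> V m `<=` V n.
Proof.
elim: n => [|n IH]; first by rewrite leqn0 => /eqP ->.
rewrite leq_eqVlt => /predU1P[->//|]; rewrite ltnS => /IH mn.
by move=> x /mn /VS.
Qed.

Lemma chain_basis m n : (m <= n)%N -> (B m `<=` B n)%fset.
Proof.
elim: n => [|n IH]; first by rewrite leqn0 => /eqP ->.
rewrite leq_eqVlt => /predU1P[->//|]; rewrite ltnS => /IH mn.
exact: fsubset_trans (BS n).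
Qed.

Lemma chain_coherent m n b x : b \in B m -> b \in B n -> V m x -> V n x ->
  e m b x = e n b x.
Proof.
wlog mn : m n / (m <= n)%N => [H|bm bn Vm Vn].
  by case: (leqP m n) => [|/ltnW] mn bm bn Vm Vn; [|symmetry]; apply: H.
rewrite [in RHS](fb_exp (Be m) Vm) (fb_coord_comb (Be n))//; last exact: chain_basis.
by rewrite bm.
Qed.

Lemma union_submod : submod_closed [in W].
Proof.
apply/submod_closedP; split; first by exists 0%N => //; exact: submod0 (fb_submod (Be 0)).
move=> a x y [m _ Vx] [n _ Vy]; exists (maxn m n) => //.
apply: (submodL (fb_submod (Be _))).
  by apply: chain_space Vx; rewrite leq_maxl.
by apply: chain_space Vy; rewrite leq_maxr.
Qed.

Lemma union_basis_fin (F : {fset E}) : [set` F] `<=` Binf ->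
  exists n, (F `<=` B n)%fset.
Proof.
move=> FB; have /choice[n Hn] : forall b, exists n, b \in F -> b \in B n.
  move=> b; have [bF|bF] := boolP (b \in F); last by exists 0%N.
  by have [n _ ?] := FB b bF; exists n.
exists (\max_(b <- F) n b)%N; apply/fsubsetP => b bF.
have /fsubsetP : (B (n b) `<=` B (\max_(b <- F) n b)%N)%fset.
  by apply: chain_basis; exact: leq_bigmax_seq.
by apply; exact: Hn.
Qed.

(** On the union the coordinate of [x] along [b] is the one computed in any stage
    that contains both; the bound [K] allows the extension to the closure. *)
Lemma limit_coordinates : exists h : E -> E -> R^o, forall b, Binf b ->
  [/\ linear_on (closure W) (h b),
      forall n x, b \in B n -> V n x -> h b x = e n b x
    & forall x, `|h b x| <= K * `|x| ].
Proof.
suff H : forall b, exists h : E -> R^o, Binf b ->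
  [/\ linear_on (closure W) h,
      forall n x, b \in B n -> V n x -> h x = e n b x
    & forall x, `|h x| <= K * `|x| ].
  by have [h Hh] := choice H; exists h.
move=> b; have [[k _ bk]|nb] := pselect (Binf b); last by exists (fun=> 0).
have /choice[g Hg] : forall x, exists c : R^o, forall n, b \in B n -> V n x -> c = e n b x.
  move=> x; have [[m [bm Vm]]|nV] := pselect (exists m, b \in B m /\ V m x).
    by exists (e m b x) => n bn Vn; exact: chain_coherent.
  by exists 0 => n bn Vn; exfalso; apply: nV; exists n.
have Wk x : W x -> exists2 n, b \in B n & V n x.
  move=> [n _ Vx]; exists (maxn k n).
    by apply: (fsubsetP (chain_basis (leq_maxl k n))).
  by apply: chain_space Vx; rewrite leq_maxr.
have gl : linear_on W g.
  move=> a x y /Wk[n bn Vx] /Wk[m bm Vy].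
  have [Bn Bm] := (fsubsetP (chain_basis (leq_maxl n m)), fsubsetP (chain_basis (leq_maxr n m))).
  have Vx' := chain_space (leq_maxl n m) Vx; have Vy' := chain_space (leq_maxr n m) Vy.
  rewrite !(Hg _ (maxn n m)) ?(fb_lin (Be _))//; try exact: Bn.
  exact: submodL (fb_submod (Be _)) _ _ _ Vx' Vy'.
have gK w : W w -> `|g w| <= K * `|w|.
  by move=> /Wk[n bn Vn]; rewrite (Hg w n)//; exact: (fb_coord_le (Be n)).
have [h [hl hg hK]] := bounded_linear_extension union_submod K0 gl gK.
exists h => _; split=> // n x bn Vn; rewrite hg ?(Hg x n)//.
by exists n.
Qed.

(** The projections are bounded on the closure only through their bound on [W]:
    for [w] in [W] near [x], the projection of [x - w] is small for the finite
    set [F] at hand, whatever its crude bound [#|` F| * K]. Once the bound [K] is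
    known for all [F], a single [w] near [x] controls all large projections
    at once. *)
Lemma completion_suppression_basis : suppression_basis K (closure W) Binf.
Proof.
have Ws := closure_submod union_submod.
have [h Hh] := limit_coordinates.
have WcW : W `<=` closure W by exact: subset_closure.
have BW : Binf `<=` closure W.
  by move=> b [n _ bn]; apply: WcW; exists n => //; exact: (fb_sub (Be n)).
have Pl (F : {fset E}) x y : [set` F] `<=` Binf -> closure W x -> closure W y ->
    \sum_(b <- F) h b (x - y) *: b = \sum_(b <- F) h b x *: b - \sum_(b <- F) h b y *: b.
  move=> FB Wx Wy; rewrite -sumrB big_seq [RHS]big_seq; apply: eq_bigr => b /FB /Hh[hl _ _].
  by rewrite (linear_onB hl)// scalerBl.
have PW (F : {fset E}) n x : (F `<=` B n)%fset -> V n x ->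
    \sum_(b <- F) h b x *: b = \sum_(b <- F) e n b x *: b.
  move=> /fsubsetP FB Vx; rewrite big_seq [RHS]big_seq; apply: eq_bigr => b /FB bn.
  have Bb : Binf b by exists n.
  by have [_ hE _] := Hh b Bb; rewrite (hE n).
have Psupp (F : {fset E}) x : [set` F] `<=` Binf -> closure W x ->
    `|\sum_(b <- F) h b x *: b| <= K * `|x|.
  move=> FB Wx; have [n Fn] := union_basis_fin FB.
  apply/ler_addgt0Pl => eps eps0.
  (* [D] adds the crude bound of the projection onto [F] to the error [K] that
     comes from replacing the norm of [w] by that of [x]. *)
  pose D := \sum_(b <- F) K + K + 1.
  have D0 : 0 < D by rewrite ltr_wpDl// addr_ge0// sumr_ge0.
  have [w [m _ Vw] xw] := (closure_normP W x).1 Wx _ (divr_gt0 eps0 D0).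
  have Ww : closure W w by apply: WcW; exists m.
  have Vw' := chain_space (leq_maxr n m) Vw.
  have Fn' := fsubset_trans Fn (chain_basis (leq_maxl n m)).
  rewrite -[\sum_(b <- F) _](subrK (\sum_(b <- F) h b w *: b)) -Pl//.
  have H1 : `|\sum_(b <- F) h b w *: b| <= K * (`|x| + `|x - w|).
    rewrite (PW F (maxn n m))// (le_trans (fb_supp (Be (maxn n m)) Fn' Vw'))//.
    by rewrite ler_wpM2l// distrC -{1}(subrK x w) addrC ler_normD.
  have H2 : `|\sum_(b <- F) h b (x - w) *: b| <= (\sum_(b <- F) K) * `|x - w|.
    rewrite (le_trans (ler_norm_sum _ _ _))// mulr_suml big_seq [leRHS]big_seq.
    apply: ler_sum => b bF; have [_ _ hK] := Hh b (FB b bF).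
    by rewrite normrZ (fb_norm (Be n) (fsubsetP Fn b bF)) mulr1.
  apply: le_trans (ler_normD _ _) _; apply: le_trans (lerD H2 H1) _.
  rewrite mulrDr addrCA addrC lerD2r -mulrDl.
  have: D * `|x - w| <= eps by rewrite mulrC -ler_pdivlMr// ltW.
  by apply: le_trans; rewrite ler_wpM2r// lerDl.
split=> //; exists h; split=> //.
- move=> b /Hh[hl _ hK]; split=> //.
  by apply: (bounded_linear_continuous (C := K)) => // x _.
- move=> b Bb; have [n _ bn] := Bb; have [_ hE _] := Hh b Bb.
  have Vb := fb_sub (Be n) bn.
  by rewrite (fb_norm (Be n))// (hE n)// (fb_kron (Be n))// eqxx.
- move=> b b' Bb [m _ bm] bb'; have [n _ bn] := Bb; have [_ hE _] := Hh b Bb.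
  have [bN bM] := (fsubsetP (chain_basis (leq_maxl n m)) _ bn,
                   fsubsetP (chain_basis (leq_maxr n m)) _ bm).
  rewrite (hE (maxn n m))//; last exact: (fb_sub (Be _)).
  by rewrite (fb_kron (Be _))//; case: eqP.
- move=> x Wx eps eps0.
  have K1 : 0 < K + 1 by rewrite ltr_wpDl.
  have [w [n _ Vw] xw] := (closure_normP W x).1 Wx _ (divr_gt0 eps0 K1).
  have Ww : closure W w by apply: WcW; exists n.
  exists (B n); split; first by move=> b bn; exists n.
  move=> G BG GB.
  have Gw : \sum_(b <- G) h b w *: b = w.
    have [m Gm] := union_basis_fin GB.
    have nm : (n <= maxn n m)%N by rewrite leq_maxl.
    rewrite (PW G (maxn n m)); last 2 first.
    - exact: fsubset_trans Gm (chain_basis (leq_maxr _ _)).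
    - exact: chain_space Vw.
    rewrite [RHS](fb_exp (Be n) Vw) (big_fsetID _ (mem (B n)))/=.
    rewrite [X in _ + X]big1_seq ?addr0; last first.
      move=> b; rewrite !inE => /andP[_ /andP[bG bn]].
      rewrite {1}(fb_exp (Be n) Vw) (fb_coord_comb (Be _)) ?(negPf bn) ?scale0r//.
        exact: chain_basis.
      exact: (fsubsetP (fsubset_trans Gm (chain_basis (leq_maxr _ _)))).
    have -> : [fset x0 in G | (mem (B n)) x0]%fset = B n.
      apply/fsetP => b; rewrite !inE andb_idl//; exact: (fsubsetP BG).
    rewrite big_seq [RHS]big_seq; apply: eq_bigr => b bn; congr (_ *: _).
    symmetry; apply: chain_coherent => //; last exact: chain_space Vw.
    exact: (fsubsetP (chain_basis nm)).
  have -> : x - \sum_(b <- G) h b x *: b = (x - w) - \sum_(b <- G) h b (x - w) *: b.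
    by rewrite Pl// Gw opprB addrA subrK.
  apply: le_lt_trans (ler_normB _ _) _.
  have Wxw := submodB Ws Wx Ww.
  apply: le_lt_trans (lerD (lexx _) (Psupp G _ GB Wxw)) _.
  by rewrite -[X in X + _]mul1r -mulrDl addrC mulrC -ltr_pdivlMr.
- by move=> F FB x Wx; exact: Psupp.
Qed.

Lemma completion_separable :
  (forall n, separable_set (V n)) -> separable_set (closure W).
Proof.
move=> sepV; have /choice[D HD] : forall n, exists D : set E,
    countable D /\ D `<=` V n /\ V n `<=` closure D.
  by move=> n; have [D D1 D2] := sepV n; exists D.
exists (\bigcup_n D n).
  by apply: bigcup_countable => // n _; have [] := HD n.
split=> [x [n _ Dx]|].
  by apply: subset_closure; exists n => //; have [_ [DV _]] := HD n; exact: DV.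
move=> x /closure_normP Wx; apply/closure_normP => eps eps0.
have e2 : 0 < eps / 2 by rewrite divr_gt0.
have [w [n _ Vw] xw] := Wx _ e2.
have [_ [_ /(_ w Vw) /closure_normP /(_ _ e2)[d Dd wd]]] := HD n.
exists d; first by exists n.
rewrite -(subrK w x) -addrA [ltRHS]splitr.
by apply: le_lt_trans (ler_normD _ _) _; exact: ltrD.
Qed.

End Completion.

(** * Hulls of finite sets are closed *)

Section ClosedHull.
Variables (R : realType) (E : completeNormedModType R).

(** The hull is the continuous image of the simplex of weights, which is
    compact. *)
Lemma convex_hull_closed (S : {fset E}) : closed (convex_hull [set` S]).
Proof.
set s := S : seq E; pose n := size s; pose p (i : 'I_n) := nth 0 s i.
have pS i : p i \in S by rewrite -[_ \in S]/(_ \in s) mem_nth.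
pose D : set 'rV[R]_n := [set v : 'rV[R]_n | forall i, `[0%R, 1%R]%classic (v ord0 i)] `&`
  [set v : 'rV[R]_n | \sum_i v ord0 i = 1].
pose phi (v : 'rV[R]_n) : E := \sum_i v ord0 i *: p i.
have Dc : compact D.
  apply: compact_closedI.
    by apply: (@rV_compact R n (fun=> `[0, 1]%classic)) => i; exact: segment_compact.
  apply: (@closed_comp _ _ (fun v : 'rV[R]_n => \sum_i v ord0 i) [set 1]).
    move=> v _; apply: continuous_big => [|i _]; first exact: add_continuous.
    exact: coord_continuous.
  exact: closed_eq.
have -> : convex_hull [set` S] = phi @` D.
  apply/seteqP; split=> x.
    move=> /convex_hull_fsetP[l [l0 l1 ->]].
    rewrite (big_nth 0) big_mkord in l1.
    exists (\row_i l (p i)); last first.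
      by rewrite /phi (big_nth 0) big_mkord; apply: eq_bigr => i _; rewrite mxE.
    split=> /=; last by under eq_bigr do rewrite mxE.
    move=> i; rewrite mxE in_itv/= l0 ?pS//= -l1 (bigD1 i)//= lerDl.
    by apply: sumr_ge0 => j _; apply: l0; exact: pS.
  move=> [v [v0 v1] <-].
  have -> : phi v = \sum_(z <- [seq (v ord0 i, p i) | i <- enum 'I_n]) z.1 *: z.2.
    by rewrite big_map big_enum.
  apply: convex_comb.
  - exact: convex_hull_convex.
  - by move=> _ /mapP[i _ ->] /=; have /andP[] := v0 i.
  - by move=> _ /mapP[i _ ->] _ /=; apply: convex_hull_sub; exact: pS.
  - by rewrite big_map big_enum.
apply: compact_closed; first exact: norm_hausdorff.
apply: continuous_compact => //; apply: continuous_subspaceT.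
apply: continuous_big => [|i _ v]; first exact: add_continuous.
by apply: (@cvgZr_tmp _ _ _ (nbhs v)); exact: coord_continuous.
Qed.

End ClosedHull.

(** * Norms on coordinate spaces *)

(** The bound [cnorm_coord] gives both definiteness of the norm and convergence
    of coordinates along Cauchy filters, so that completeness needs no argument on
    the equivalence of norms. *)
Record coord_norm (R : realType) (I : finType) := CoordNorm {
  cnorm :> {ffun I -> R^o} -> R ;
  cnormD : forall x y, cnorm (x + y) <= cnorm x + cnorm y ;
  cnormZ : forall (l : R) x, cnorm (l *: x) = `|l| * cnorm x ;
  cbound : R ;
  cbound_ge0 : 0 <= cbound ;
  cnorm_coord : forall (x : {ffun I -> R^o}) i, `|x i| <= cbound * cnorm x }.

(** A copy of the coordinate space for each norm, to carry the corresponding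
    topology. *)
Definition cspace (R : realType) (I : finType) (p : coord_norm R I) : Type :=
  {ffun I -> R^o}.

Section CoordSpace.
Variables (R : realType) (I : finType) (p : coord_norm R I).

Lemma cnorm0_eq0 (x : {ffun I -> R^o}) : p x = 0 -> x = 0.
Proof.
move=> px0; apply/ffunP => i; apply/eqP; rewrite ffunE -normr_le0.
by rewrite (le_trans (cnorm_coord p x i))// px0 mulr0.
Qed.

HB.instance Definition _ := GRing.Lmodule.on (cspace p).
HB.instance Definition _ := Lmodule_isNormed.Build R (cspace p)
  (@cnormD R I p) (@cnormZ R I p) cnorm0_eq0.

Lemma cspace_normE (x : cspace p) : `|x| = p x.
Proof. by []. Qed.

Definition cunit (i : I) : cspace p := [ffun j => ((j == i)%:R : R^o)].

Lemma cspace_sum (x : cspace p) : x = \sum_i x i *: cunit i.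
Proof.
apply/ffunP => j; rewrite sum_ffunE (bigD1 j)//= !ffunE eqxx big1.
  by rewrite addr0 scaler1.
by move=> i ij; rewrite !ffunE eq_sym (negPf ij) scaler0.
Qed.

Lemma cspace_complete (F : set_system (cspace p)) :
  ProperFilter F -> cauchy F -> cvg F.
Proof.
move=> FF Fc.
have coordL (i : I) (x y : cspace p) : `|x i - y i| <= cbound p * `|x - y|.
  have := cnorm_coord p (x - y) i.
  by rewrite !ffunE.
have cv i : cvg ((fun x : cspace p => x i) @ F).
  apply: R_complete; apply/cauchy_ballP => _/posnumP[e].
  have c0 : 0 < cbound p + 1 by rewrite ltr_wpDl // cbound_ge0.
  have /cauchy_ballP /(_ (e%:num / (cbound p + 1))) := Fc.
  rewrite divr_gt0// => /(_ isT) H.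
  rewrite !near_simpl; apply: filterS H => -[x y]; rewrite -!ball_normE /= => xy.
  apply: le_lt_trans (coordL i x y) _.
  move: xy; rewrite ltr_pdivlMr// mulrC; apply: le_lt_trans.
  by rewrite ler_wpM2r // lerDl.
apply/cvg_ex.
exists ([ffun i => (lim ((fun x : cspace p => x i) @ F) : R^o)] : cspace p).
set l := (X in _ --> X).
suff : (fun x : cspace p => \sum_i x i *: cunit i) @ F --> \sum_i l i *: cunit i.
  rewrite -cspace_sum; apply: cvg_trans.
  by rewrite (_ : (fun x => _) = id) //; apply/funext => x; rewrite -cspace_sum.
apply: cvg_big => [|i _]; first exact: add_continuous.
apply: cvgZr_tmp.
by rewrite ffunE; exact: cv.
Qed.

HB.instance Definition _ := Uniform_isComplete.Build (cspace p) cspace_complete.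
End CoordSpace.

Section CoordSpaceBasis.
Variables (R : realType) (I : finType).

Definition restrict (J : pred I) (y : {ffun I -> R^o}) : {ffun I -> R^o} :=
  [ffun i => if J i then y i else 0].

Variables (p : coord_norm R I) (K : R).
Hypothesis p1 : forall i, p (cunit p i) = 1.
Hypothesis pK : forall J y, p (restrict J y) <= K * p y.

Definition cbasis : {fset cspace p} := [fset cunit p i | i : I]%fset.
(** The functionals of a basis are indexed by its vectors, so the index of [b] has
    to be recovered; the sum has at most one term. *)
Definition ccoord (b y : cspace p) : R^o := \sum_(i | b == cunit p i) y i.

Lemma cunit_inj : injective (cunit p).
Proof.
move=> i j /ffunP /(_ i); rewrite !ffunE eqxx.
by case: eqVneq => // _ /eqP; rewrite (oner_eq0 R).
Qed.

Lemma ccoordE i y : ccoord (cunit p i) y = y i.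
Proof. by rewrite /ccoord (big_pred1 i)// => j; rewrite (inj_eq cunit_inj). Qed.

Lemma cbasisP b : reflect (exists i, b = cunit p i) (b \in cbasis).
Proof.
apply: (iffP (imfsetP _ _ _ _)) => -[i]; first by move=> _ ->; exists i.
by move=> ->; exists i.
Qed.

Lemma ccoord_sum (F : {fset cspace p}) (y : cspace p) : (F `<=` cbasis)%fset ->
  \sum_(b <- F) ccoord b y *: b = restrict (fun i => cunit p i \in F) y :> cspace p.
Proof.
move=> /fsubsetP FB; apply/ffunP => j; rewrite sum_ffunE ffunE.
under eq_bigr do rewrite ffunE.
have H b : b \in F -> b != cunit p j -> b j = 0.
  move=> /FB /cbasisP[i ->]; rewrite (inj_eq cunit_inj) ffunE eq_sym => /negPf ->.
  by [].
case: ifPn => jF.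
  rewrite (big_fsetD1 _ jF)/= ccoordE ffunE eqxx scaler1 big_seq big1 ?addr0//.
  by move=> b; rewrite !inE => /andP[bj bF]; rewrite H// scaler0.
rewrite big_seq big1// => b bF; rewrite H ?scaler0//.
by apply: contraNneq jF => <-.
Qed.

Lemma cspace_fin_basis : fin_basis K [set: cspace p] cbasis ccoord.
Proof.
split=> //.
- by apply/submod_closedP.
- move=> b /cbasisP[i ->] a x y _ _.
  by rewrite !ccoordE !ffunE.
- by move=> b /cbasisP[i ->]; rewrite cspace_normE p1.
- move=> b b' /cbasisP[i ->] /cbasisP[j ->].
  by rewrite ccoordE ffunE (inj_eq cunit_inj).
- move=> x _; rewrite ccoord_sum//; apply/ffunP => i; rewrite ffunE ifT//.
  by apply/cbasisP; exists i.
- by move=> F FB x _; rewrite ccoord_sum// !cspace_normE; exact: pK.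
Qed.

Lemma cspace_separable : separable_set [set: cspace p].
Proof.
exists (range (fun q : {ffun I -> rat} => [ffun i => ratr (q i) : R^o] : cspace p)).
  apply: (@sub_countable _ _ _ [set: {ffun I -> rat}]); first exact: card_image_le.
  exact: countableP.
split=> // x _; apply/closure_normP => eps eps0.
pose d := eps / (#|I|%:R + 1).
have d0 : 0 < d by rewrite divr_gt0// ltr_wpDl.
have /fin_all_exists[q Hq] : forall i, exists q : rat, `|x i - ratr q| < d.
  move=> i; have : x i - d < x i + d by rewrite ltrD2l gtrN.
  move=> /rat_in_itvoo[q]; rewrite in_itv/= => q1; exists q.
  by rewrite distrC ltr_distl.
exists ([ffun i => ratr (q i) : R^o]).
  by exists (finfun q) => //; apply/ffunP => i; rewrite !ffunE.
rewrite (cspace_sum (_ - _)); apply: le_lt_trans (ler_norm_sum _ _ _) _.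
apply: (@le_lt_trans _ _ (\sum_(i : I) d)).
  apply: ler_sum => i _; rewrite normrZ cspace_normE p1 mulr1 !ffunE.
  exact/ltW.
rewrite sumr_const -mulr_natl /d mulrCA gtr_pMr// ltr_pdivrMr ?ltr_wpDl//.
by rewrite mul1r ltrDl.
Qed.

Lemma cspace_K_based : K_based K (BasedData [set: cspace p] [set` cbasis]).
Proof.
have Be := cspace_fin_basis.
split; first by split; [exact: (fb_submod Be) | exact: closedT | exact: cspace_separable].
split=> //; exists ccoord; split.
- move=> b bB; split; first exact: (fb_lin Be).
  apply: (bounded_linear_continuous (C := K)); first exact: (fb_submod Be).
    exact: (fb_lin Be).
  by move=> x; exact: (fb_coord_le Be).
- by move=> b bB; rewrite (fb_norm Be)// (fb_kron Be)// eqxx.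
- by move=> b b' bB bB' /eqP/negPf bb'; rewrite (fb_kron Be)// bb'.
- move=> x Vx eps eps0; exists cbasis; split=> // G BG GB.
  suff <- : cbasis = G by rewrite -(fb_exp Be)// subrr normr0.
  by apply/eqP; rewrite eqEfsubset BG; apply/fsubsetP.
- by move=> F FB x Vx; apply: (fb_supp Be) => //; apply/fsubsetP.
Qed.

End CoordSpaceBasis.

(** * Gluing two normed spaces *)

(** The data of the gluing are two maps that jointly cover a coordinate space and
    whose images meet isometrically ([f12]): an identification of vectors of [V1]
    and [V2] must not change their norm. *)
Section Gluing.
Variables (R : realType) (K : R) (I : finType).
Variables (E1 E2 : completeNormedModType R) (V1 : set E1) (V2 : set E2).
Variables (f1 : E1 -> {ffun I -> R^o}) (f2 : E2 -> {ffun I -> R^o}).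
Hypothesis K0 : 0 <= K.
Hypothesis V1s : submod_closed [in V1].
Hypothesis V2s : submod_closed [in V2].
Hypothesis f1l : linear_on V1 f1.
Hypothesis f2l : linear_on V2 f2.
Hypothesis f12 : forall x1 x2, V1 x1 -> V2 x2 -> f1 x1 = f2 x2 -> `|x1| = `|x2|.
Hypothesis f12_onto : forall y, exists x1 x2, [/\ V1 x1, V2 x2 & y = f1 x1 + f2 x2].
Hypothesis f1K : forall (J : pred I) x, V1 x ->
  exists x', [/\ V1 x', f1 x' = restrict J (f1 x) & `|x'| <= K * `|x| ].
Hypothesis f2K : forall (J : pred I) x, V2 x ->
  exists x', [/\ V2 x', f2 x' = restrict J (f2 x) & `|x'| <= K * `|x| ].
Hypothesis f12_unit : forall i,
  (exists x, [/\ V1 x, f1 x = [ffun j => ((j == i)%:R : R^o)] & `|x| = 1]) \/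
  (exists x, [/\ V2 x, f2 x = [ffun j => ((j == i)%:R : R^o)] & `|x| = 1]).

Definition glue_norms (y : {ffun I -> R^o}) : set R :=
  [set r | exists x1 x2, [/\ V1 x1, V2 x2, y = f1 x1 + f2 x2 & r = `|x1| + `|x2| ]].
Definition glue_norm (y : {ffun I -> R^o}) : R := inf (glue_norms y).

Lemma glue_norms_lb y : lbound (glue_norms y) 0.
Proof. by move=> _ [x1 [x2 [_ _ _ ->]]]; rewrite addr_ge0. Qed.

Lemma glue_norm_le x1 x2 : V1 x1 -> V2 x2 -> glue_norm (f1 x1 + f2 x2) <= `|x1| + `|x2|.
Proof.
move=> Vx1 Vx2; apply: ge_inf; first by exists 0; exact: glue_norms_lb.
by exists x1, x2.
Qed.

Lemma glue_norm_approx y eps : 0 < eps -> exists x1 x2,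
  [/\ V1 x1, V2 x2, y = f1 x1 + f2 x2 & `|x1| + `|x2| < glue_norm y + eps].
Proof.
move=> eps0; have [|r [x1 [x2 [H1 H2 H3 ->]]] H4] := @inf_adherent _ (glue_norms y) _ eps0.
  split; last by exists 0; exact: glue_norms_lb.
  by have [x1 [x2 [H1 H2 H3]]] := f12_onto y; exists (`|x1| + `|x2|), x1, x2.
by exists x1, x2.
Qed.

Lemma glue_norm_ge y (c : R) :
  (forall x1 x2, V1 x1 -> V2 x2 -> y = f1 x1 + f2 x2 -> c <= `|x1| + `|x2|) ->
  c <= glue_norm y.
Proof.
move=> H; apply/ler_addgt0Pr => eps eps0.
have [x1 [x2 [V1x V2x yE le]]] := glue_norm_approx y eps0.
exact: le_trans (H _ _ V1x V2x yE) (ltW le).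
Qed.

(** If [f1 x = f1 x1 + f2 x2] then [x - x1] is identified with [x2], so both have
    the same norm, and the triangle inequality in [V1] applies. *)
Lemma glue_norm1 x : V1 x -> glue_norm (f1 x) = `|x|.
Proof.
move=> Vx; apply/eqP; rewrite eq_le; apply/andP; split.
  have := glue_norm_le Vx (submod0 V2s).
  by rewrite (linear_on0 V2s f2l) normr0 !addr0.
apply: glue_norm_ge => x1 x2 Vx1 Vx2 xE.
rewrite -(f12 (submodB V1s Vx Vx1) Vx2); last by rewrite (linear_onB f1l)// xE addrC addKr.
by rewrite addrC -{1}(subrK x1 x) ler_normD.
Qed.

Lemma glue_norm2 x : V2 x -> glue_norm (f2 x) = `|x|.
Proof.
move=> Vx; apply/eqP; rewrite eq_le; apply/andP; split.
  have := glue_norm_le (submod0 V1s) Vx.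
  by rewrite (linear_on0 V1s f1l) normr0 !add0r.
apply: glue_norm_ge => x1 x2 Vx1 Vx2 xE.
rewrite (f12 Vx1 (submodB V2s Vx Vx2)); last by rewrite (linear_onB f2l)// xE addrK.
by rewrite -{1}(subrK x2 x) ler_normD.
Qed.

Lemma glue_normD x y : glue_norm (x + y) <= glue_norm x + glue_norm y.
Proof.
apply/ler_addgt0Pr => eps eps0; have e2 : 0 < eps / 2 by rewrite divr_gt0.
have [x1 [x2 [Vx1 Vx2 xE lex]]] := glue_norm_approx x e2.
have [y1 [y2 [Vy1 Vy2 yE ley]]] := glue_norm_approx y e2.
have := glue_norm_le (submodD V1s Vx1 Vy1) (submodD V2s Vx2 Vy2).
rewrite (linear_onD f1l)// (linear_onD f2l)// addrACA -xE -yE => /le_trans; apply.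
apply: le_trans (lerD (ler_normD _ _) (ler_normD _ _)) _.
rewrite addrACA [eps]splitr [leRHS]addrACA; apply: lerD; exact: ltW.
Qed.

Lemma glue_norm0 : glue_norm 0 = 0.
Proof. by rewrite -(linear_on0 V1s f1l) glue_norm1 ?normr0//; exact: submod0. Qed.

Lemma glue_normZ (l : R) y : glue_norm (l *: y) = `|l| * glue_norm y.
Proof.
have H k z : glue_norm (k *: z) <= `|k| * glue_norm z.
  have k1 : 0 < `|k| + 1 by rewrite ltr_wpDl.
  apply/ler_addgt0Pr => eps eps0.
  have [x1 [x2 [Vx1 Vx2 zE lez]]] := glue_norm_approx z (divr_gt0 eps0 k1).
  have := glue_norm_le (submodZ V1s k Vx1) (submodZ V2s k Vx2).
  rewrite (linear_onZ V1s f1l)// (linear_onZ V2s f2l)// -scalerDr -zE !normrZ -mulrDr.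
  move=> /le_trans; apply; apply: le_trans (ler_wpM2l _ (ltW lez)) _ => //.
  rewrite mulrDr lerD2l mulrCA ger_pMr// ler_pdivrMr// mul1r lerDl//.
apply/eqP; rewrite eq_le H/=; have [->|l0] := eqVneq l 0.
  by rewrite normr0 mul0r scale0r glue_norm0.
rewrite -ler_pdivlMl ?normr_gt0//.
have := H l^-1 (l *: y); by rewrite scalerA mulVf// scale1r normfV.
Qed.

Lemma restrictD J (x y : {ffun I -> R^o}) : restrict J (x + y) = restrict J x + restrict J y.
Proof. by apply/ffunP => i; rewrite !ffunE; case: ifP => //; rewrite addr0. Qed.

(** The restriction of a decomposition is a decomposition of the restriction. *)
Lemma glue_norm_restrict J y : glue_norm (restrict J y) <= K * glue_norm y.
Proof.
have K1 : 0 < K + 1 by rewrite ltr_wpDl.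
apply/ler_addgt0Pr => eps eps0.
have [x1 [x2 [Vx1 Vx2 yE ley]]] := glue_norm_approx y (divr_gt0 eps0 K1).
have [z1 [Vz1 z1E z1K]] := f1K J Vx1; have [z2 [Vz2 z2E z2K]] := f2K J Vx2.
rewrite yE restrictD -z1E -z2E; apply: le_trans (glue_norm_le Vz1 Vz2) _.
apply: le_trans (lerD z1K z2K) _; rewrite -mulrDr -yE.
apply: le_trans (ler_wpM2l K0 (ltW ley)) _.
by rewrite mulrDr lerD2l mulrCA ger_pMr// ler_pdivrMr// mul1r lerDl.
Qed.

Lemma glue_norm_unit i : glue_norm [ffun j => ((j == i)%:R : R^o)] = 1.
Proof.
have [[x [Vx <- <-]]|[x [Vx <- <-]]] := f12_unit i; first exact: glue_norm1.
exact: glue_norm2.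
Qed.

(** The restriction to one index is a multiple of a unit vector, whose norm
    is 1. *)
Lemma glue_norm_coord (y : {ffun I -> R^o}) i : `|y i| <= K * glue_norm y.
Proof.
apply: le_trans (glue_norm_restrict (pred1 i) y).
have -> : restrict (pred1 i) y = y i *: [ffun j => ((j == i)%:R : R^o)].
  apply/ffunP => j; rewrite !ffunE /=; case: eqVneq => [->|_].
    by rewrite scaler1.
  by rewrite scaler0.
by rewrite glue_normZ glue_norm_unit mulr1.
Qed.

Definition glue : coord_norm R I :=
  CoordNorm glue_normD glue_normZ K0 glue_norm_coord.

Lemma glue_fin_basis : fin_basis K [set: cspace glue] (cbasis glue) (@ccoord R I glue).
Proof.
apply: cspace_fin_basis; first exact: glue_norm_unit.
exact: glue_norm_restrict.
Qed.

Lemma glue_K_based :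
  K_based K (BasedData [set: cspace glue] [set` cbasis glue]).
Proof.
apply: cspace_K_based => //; first exact: glue_norm_unit.
exact: glue_norm_restrict.
Qed.

(** A vector [y] of norm at most 1 has decompositions of total norm below
    [1 + eps]. Dividing by [1 + eps] writes a vector close to [y] as a combination
    of a vector of each ball with total weight below 1, hence as a point of the
    hull, 0 taking the rest of the weight. *)
Lemma glue_ball (S1 : {fset E1}) (S2 : {fset E2}) :
  [set x | V1 x /\ `|x| <= 1] = convex_hull [set` S1] ->
  [set x | V2 x /\ `|x| <= 1] = convex_hull [set` S2] ->
  [set x : cspace glue | [set: cspace glue] x /\ `|x| <= 1] =
  convex_hull [set` ([fset (f1 s : cspace glue) | s in S1] `|`
                     [fset (f2 s : cspace glue) | s in S2])%fset].
Proof.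
move=> b1 b2; set S := (_ `|` _)%fset.
have S1V s : s \in S1 -> V1 s /\ `|s| <= 1.
  by move=> sS; have : convex_hull [set` S1] s by [exact: convex_hull_sub]; rewrite -b1.
have S2V s : s \in S2 -> V2 s /\ `|s| <= 1.
  by move=> sS; have : convex_hull [set` S2] s by [exact: convex_hull_sub]; rewrite -b2.
apply/seteqP; split=> y; last first.
  apply: convex_hull_min.
    apply/convex_setP => u v t t0 t1 [_ u1] [_ v1]; split=> //.
    apply: le_trans (ler_normD _ _) _; rewrite !normrZ.
    rewrite (ger0_norm t0) ger0_norm ?subr_ge0//.
    by rewrite -[leRHS](subrK t) [leRHS]addrC lerD// ler_piMr// subr_ge0.
  move=> v /=; rewrite in_fsetU => /orP[|] /imfsetP[s /= sS ->].
    by rewrite cspace_normE/= glue_norm1; have [] := S1V s sS.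
  by rewrite cspace_normE/= glue_norm2; have [] := S2V s sS.
move=> [_ y1].
have /convex_setP Sc := @convex_hull_convex R (cspace glue) [set` S].
have h1 x : V1 x -> `|x| <= 1 -> convex_hull [set` S] (f1 x : cspace glue).
  move=> Vx x1; have : convex_hull [set` S1] x by rewrite -b1.
  pose C := [set x | V1 x /\ convex_hull [set` S] (f1 x : cspace glue)].
  suff : convex_hull [set` S1] `<=` C by move=> /[apply] -[].
  apply: convex_hull_min.
    apply/convex_setP => u v t t0 t1 [Vu Su] [Vv Sv]; split.
      by apply: submodD => //; exact: submodZ.
    rewrite (linear_onD f1l); [|exact: submodZ..].
    by rewrite !(linear_onZ V1s f1l)//; exact: Sc.
  move=> s /= sS; split; first by have [] := S1V s sS.
  by apply: convex_hull_sub; rewrite /= in_fsetU in_imfset.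
have h2 x : V2 x -> `|x| <= 1 -> convex_hull [set` S] (f2 x : cspace glue).
  move=> Vx x1; have : convex_hull [set` S2] x by rewrite -b2.
  pose C := [set x | V2 x /\ convex_hull [set` S] (f2 x : cspace glue)].
  suff : convex_hull [set` S2] `<=` C by move=> /[apply] -[].
  apply: convex_hull_min.
    apply/convex_setP => u v t t0 t1 [Vu Su] [Vv Sv]; split.
      by apply: submodD => //; exact: submodZ.
    rewrite (linear_onD f2l); [|exact: submodZ..].
    by rewrite !(linear_onZ V2s f2l)//; exact: Sc.
  move=> s /= sS; split; first by have [] := S2V s sS.
  by apply: convex_hull_sub; rewrite /= in_fsetU in_imfset ?orbT.
apply: (@convex_hull_closed R (cspace glue) S); apply/closure_normP => eps eps0.
have [x1 [x2 [Vx1 Vx2 yE ley]]] := glue_norm_approx y eps0.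
pose c := 1 + eps; have c0 : 0 < c by rewrite addr_gt0.
have unitb (W : completeNormedModType R) (x : W) : `| `|x|^-1 *: x| <= 1.
  rewrite normrZ normfV normr_id; have [->|x0] := eqVneq x 0; first by rewrite normr0 mulr0.
  by rewrite mulVf// normr_eq0.
have unitE (W : completeNormedModType R) (x : W) :
    (`|x| / c) *: (`|x|^-1 *: x) = c^-1 *: x.
  rewrite scalerA mulrAC; have [->|x0] := eqVneq x 0; first by rewrite !scaler0.
  by rewrite divff ?mul1r// normr_eq0.
exists (c^-1 *: (y : cspace glue)); last first.
  rewrite -{1}[y]scale1r -scalerBl normrZ.
  have -> : 1 - c^-1 = eps / c by rewrite /c; field; rewrite gt_eqF.
  rewrite ger0_norm ?divr_ge0// ?ltW//.
  apply: le_lt_trans (ler_wpM2l _ y1) _; first by rewrite divr_ge0// ltW.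
  by rewrite mulr1 ltr_pdivrMr// ltr_pMr// ltrDl.
have -> : c^-1 *: (y : cspace glue) = \sum_(z <- [::
    (`|x1| / c, (f1 (`|x1|^-1 *: x1) : cspace glue));
    (`|x2| / c, (f2 (`|x2|^-1 *: x2) : cspace glue));
    (1 - `|x1| / c - `|x2| / c, (0 : cspace glue))]) z.1 *: z.2.
  rewrite !big_cons big_nil /= scaler0 !addr0.
  rewrite -(linear_onZ V1s f1l) ?unitE; last exact: submodZ.
  rewrite -(linear_onZ V2s f2l) ?unitE; last exact: submodZ.
  by rewrite (linear_onZ V1s f1l)// (linear_onZ V2s f2l)// -scalerDr yE.
apply: convex_comb => //.
- exact: convex_hull_convex.
- move=> z; rewrite !inE => /or3P[] /eqP -> /=; try by rewrite divr_ge0// ltW.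
  rewrite -addrA -opprD subr_ge0 -mulrDl ler_pdivrMr// mul1r.
  by rewrite (le_trans (ltW ley))// lerD2r.
- move=> z; rewrite !inE => /or3P[] /eqP -> _ /=.
  + by apply: h1; [exact: submodZ | exact: unitb].
  + by apply: h2; [exact: submodZ | exact: unitb].
  + by rewrite -(linear_on0 V1s f1l); apply: h1; [exact: submod0 | rewrite normr0].
- by rewrite !big_cons big_nil /=; ring.
Qed.

End Gluing.

(** * Amalgams *)

Section Amalgam.
Variables (R : realType) (K K' : R) (E F : completeNormedModType R).
Variables (V : set E) (B : {fset E}) (e : E -> E -> R^o).
Variables (A : set F) (C : {fset F}) (c : F -> F -> R^o).
Variables (L : set F) (D : {fset F}) (d : F -> F -> R^o).
Variable f : F -> E.
Hypothesis K0 : 0 <= K.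
Hypothesis Be : fin_basis K V B e.
Hypothesis Cc : fin_basis K A C c.
Hypothesis Dd : fin_basis K' L D d.
Hypothesis LA : L `<=` A.
Hypothesis DC : (D `<=` C)%fset.
Hypothesis fl : linear_on L f.
Hypothesis fV : forall x, L x -> V (f x).
Hypothesis fB : forall b, b \in D -> f b \in B.
Hypothesis fn : forall x, L x -> `|f x| = `|x|.

Let Vs := fb_submod Be.
Let As := fb_submod Cc.
Let Ls := fb_submod Dd.
Let DCs := fsubsetP DC.

(** The basis vectors in [D] are represented by their images in [B]. *)
Definition amalgam_index : finType := (B + (C `\` D)%fset)%type.

(** The projection onto [L] need not be a contraction; it only serves to write the
    map from [A], whose part in [L] is transported by [f]. *)
Definition proj_common (x : F) : F := \sum_(b <- D) c b x *: b.

Definition amalgam_left (x : F) : {ffun amalgam_index -> R^o} :=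
  [ffun i => match i with
             | inl u => e (val u) (f (proj_common x)) | inr b => c (val b) x end].

Definition amalgam_right (x : E) : {ffun amalgam_index -> R^o} :=
  [ffun i => match i with inl u => e (val u) x | inr _ => 0 end].

Lemma proj_common_in x : L (proj_common x).
Proof. exact: (fb_comb Dd). Qed.

Lemma proj_common_id x : L x -> proj_common x = x.
Proof.
move=> Lx; apply: (fb_coordP Cc); [exact: LA (proj_common_in x) | exact: LA|].
move=> b bC; rewrite (fb_coord_comb Cc)//; case: ifPn => // bD.
by move: Lx; rewrite (coordinate_subspace Cc Dd LA DC) => -[_ ->].
Qed.

Lemma coord_proj_common u x : u \in B ->
  e u (f (proj_common x)) = \sum_(b <- D) c b x *: ((u == f b)%:R : R^o).
Proof.
move=> uB; have DL b : b \in D -> true -> L b by move=> bD _; exact: (fb_sub Dd).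
rewrite /proj_common (linear_on_sum Ls fl)// (linear_on_sum Vs (fb_lin Be uB)).
  by rewrite big_seq [RHS]big_seq; apply: eq_bigr => b /fB ?; rewrite (fb_kron Be).
by move=> b bD _; apply: fV; exact: DL.
Qed.

Lemma proj_common_linear : linear_on A proj_common.
Proof.
move=> a x y Ax Ay; rewrite /proj_common scaler_sumr -big_split big_seq [RHS]big_seq.
apply: eq_bigr => b /DCs bC; rewrite (fb_lin Cc)//=.
by rewrite scalerDl scalerA.
Qed.

Lemma amalgam_left_linear : linear_on A amalgam_left.
Proof.
move=> a x y Ax Ay; apply/ffunP => -[u|b]; rewrite !ffunE.
  rewrite proj_common_linear// fl; [|exact: proj_common_in..].
  by rewrite (fb_lin Be (valP u))//; apply: fV; exact: proj_common_in.
apply: (fb_lin Cc) => //.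
by have := valP b; rewrite inE => /andP[].
Qed.

Lemma amalgam_right_linear : linear_on V amalgam_right.
Proof.
move=> a x y Vx Vy; apply/ffunP => -[u|b]; rewrite !ffunE.
  by rewrite (fb_lin Be (valP u)).
by rewrite scaler0 addr0.
Qed.

Lemma amalgam_agree x : L x -> amalgam_left x = amalgam_right (f x).
Proof.
move=> Lx; apply/ffunP => -[u|b]; rewrite !ffunE ?proj_common_id//.
move: Lx; rewrite (coordinate_subspace Cc Dd LA DC) => -[_]; apply.
all: by have := valP b; rewrite inE => /andP[].
Qed.

(** If the images of [x] and [y] agree, the coordinates of [x] outside [D] vanish,
    so [x] is in [L] and [f x = y]. *)
Lemma amalgam_meet x y : A x -> V y -> amalgam_left x = amalgam_right y ->
  `|x| = `|y|.
Proof.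
move=> Ax Vy /ffunP xy.
have Lx : L x.
  rewrite (coordinate_subspace Cc Dd LA DC); split=> // b bC bD.
  have bCD : b \in (C `\` D)%fset by rewrite inE bD.
  by have := xy (inr [` bCD]%fset); rewrite !ffunE.
rewrite -fn//; congr (`|_|); apply: (fb_coordP Be) => //; first exact: fV.
move=> u uB; have := xy (inl [` uB]%fset).
by rewrite !ffunE proj_common_id.
Qed.

Lemma amalgam_left_unit (b : F) (bCD : b \in (C `\` D)%fset) :
  amalgam_left b = [ffun j => ((j == inr [` bCD]%fset)%:R : R^o)].
Proof.
have /andP[bD bC] : (b \notin D) && (b \in C) by move: bCD; rewrite inE.
apply/ffunP => -[u|b']; rewrite !ffunE.
  rewrite coord_proj_common ?(valP u)// big_seq big1// => b' b'D.
  rewrite (fb_kron Cc)// ?DCs//; case: eqVneq => [bb'|]; last by rewrite scale0r.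
  by rewrite -bb' b'D in bD.
by rewrite (fb_kron Cc)//; have := valP b'; rewrite inE => /andP[].
Qed.

Lemma amalgam_right_unit (u : B) :
  amalgam_right (val u) = [ffun j => ((j == inl u)%:R : R^o)].
Proof.
apply/ffunP => -[v|b]; rewrite !ffunE// (fb_kron Be) ?(valP u) ?(valP v)//.
Qed.

Lemma amalgam_unit i :
  (exists x, [/\ A x, amalgam_left x = [ffun j => ((j == i)%:R : R^o)] & `|x| = 1]) \/
  (exists x, [/\ V x, amalgam_right x = [ffun j => ((j == i)%:R : R^o)] & `|x| = 1]).
Proof.
case: i => [u|b]; [right; exists (val u)|left; exists (val b)].
  rewrite amalgam_right_unit; split=> //; first exact: (fb_sub Be (valP u)).
  exact: (fb_norm Be (valP u)).
have bC : val b \in C by have := valP b; rewrite inE => /andP[].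
split; [exact: (fb_sub Cc)| |exact: (fb_norm Cc)].
have bE : [` valP b]%fset = b by exact: val_inj.
by rewrite (amalgam_left_unit (valP b)) bE.
Qed.

Lemma amalgam_onto y : exists x1 x2,
  [/\ A x1, V x2 & y = amalgam_left x1 + amalgam_right x2].
Proof.
pose k2 (v : E) : R := if insub v is Some u then y (inl u) else 0.
pose k1 (v : F) : R := if insub v is Some b then y (inr b) else 0.
have CDC : (C `\` D `<=` C)%fset by exact: fsubsetDl.
exists (\sum_(b <- (C `\` D)%fset) k1 b *: b), (\sum_(b <- B) k2 b *: b); split.
- apply: submod_sum => // b bCD _; apply: submodZ => //.
  exact: (fb_sub Cc (fsubsetP CDC _ bCD)).
- exact: (fb_comb Be).
apply/ffunP => -[u|b]; rewrite !ffunE.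
  rewrite (fb_coord_comb Be) ?(valP u)// /k2 valK coord_proj_common ?(valP u)//.
  rewrite big_seq big1 ?add0r// => b bD.
  by rewrite (fb_coord_comb Cc)// ?DCs// inE bD/= scale0r.
have bC := fsubsetP CDC _ (valP b).
by rewrite (fb_coord_comb Cc)// (valP b) /k1 valK addr0.
Qed.

Lemma amalgam_right_restrict (J : pred amalgam_index) x : V x ->
  exists x', [/\ V x', amalgam_right x' = restrict J (amalgam_right x)
    & `|x'| <= K * `|x| ].
Proof.
move=> Vx; pose G := [fset b in B | if insub b is Some u then J (inl u) else false]%fset.
have GB : (G `<=` B)%fset by apply/fsubsetP => b; rewrite !inE => /andP[].
exists (\sum_(b <- G) e b x *: b); split; last exact: (fb_supp Be).
  apply: submod_sum => // b /(fsubsetP GB) bB _; apply: submodZ => //; exact: (fb_sub Be).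
apply/ffunP => -[u|b]; rewrite !ffunE; last by case: ifP.
by rewrite (fb_coord_comb Be) ?(valP u)// !inE valK (valP u).
Qed.

(** Restricting the image of [x] to [J] means to keep the basis vectors of [C]
    whose index in the amalgam is in [J]; for a vector of [D] this is the index of
    its image under [f]. *)
Lemma amalgam_left_restrict (J : pred amalgam_index) x : A x ->
  exists x', [/\ A x', amalgam_left x' = restrict J (amalgam_left x)
    & `|x'| <= K * `|x| ].
Proof.
move=> Ax.
pose kept b := if b \in D then (if insub (f b) is Some u then J (inl u) else false)
  else (if insub b is Some b' then J (inr b') else false).
pose G := [fset b in C | kept b]%fset.
have GC : (G `<=` C)%fset by apply/fsubsetP => b; rewrite !inE => /andP[].
exists (\sum_(b <- G) c b x *: b); split; last exact: (fb_supp Cc).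
  apply: submod_sum => // b /(fsubsetP GC) bC _; apply: submodZ => //; exact: (fb_sub Cc).
apply/ffunP => -[u|b]; rewrite !ffunE.
  rewrite !coord_proj_common ?(valP u)//.
  transitivity (\sum_(b <- D) if J (inl u) then c b x *: ((val u == f b)%:R : R^o) else 0).
    rewrite big_seq [RHS]big_seq; apply: eq_bigr => b bD; have bC := DCs bD.
    rewrite (fb_coord_comb Cc)// !inE bC/= /kept bD.
    case: eqVneq => [<-|_]; last by rewrite !scaler0 if_same.
    by rewrite valK; case: ifP => //; rewrite scale0r.
  by case: ifP => // _; rewrite big1.
have /andP[bD bC] : (val b \notin D) && (val b \in C) by have := valP b; rewrite inE.
by rewrite (fb_coord_comb Cc)// !inE bC/= /kept (negPf bD) valK.
Qed.

Definition amalgam : coord_norm R amalgam_index :=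
  glue K0 As Vs amalgam_left_linear amalgam_right_linear amalgam_meet amalgam_onto
    amalgam_left_restrict amalgam_right_restrict amalgam_unit.

Lemma amalgam_left_basis b : b \in C -> (amalgam_left b : cspace amalgam) \in cbasis amalgam.
Proof.
move=> bC; apply/cbasisP; have [bD|bD] := boolP (b \in D).
  exists (inl [` fB bD]%fset).
  rewrite amalgam_agree; last exact: (fb_sub Dd).
  by rewrite -[f b]/(val [` fB bD]%fset) amalgam_right_unit.
have bCD : b \in (C `\` D)%fset by rewrite inE bD.
by exists (inr [` bCD]%fset); exact: amalgam_left_unit.
Qed.

Lemma amalgam_rational : rational_fin (BasedData V [set` B]) ->
  rational_fin (BasedData A [set` C]) ->
  rational_fin (BasedData [set: cspace amalgam] [set` cbasis amalgam]).
Proof.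
move=> Vr Ar.
have [S2 [S2Q S2V]] := rational_fin_coords Be Vr.
have [S1 [S1Q S1V]] := rational_fin_coords Cc Ar.
have Ye := glue_fin_basis K0 As Vs amalgam_left_linear amalgam_right_linear
  amalgam_meet amalgam_onto amalgam_left_restrict amalgam_right_restrict amalgam_unit.
split; first exact: fin_basis_finite_dim Ye.
have H := glue_ball K0 As Vs amalgam_left_linear amalgam_right_linear amalgam_meet amalgam_onto
    amalgam_left_restrict amalgam_right_restrict amalgam_unit S1V S2V.
eexists; split; last exact: H.
move=> v vS; apply/(fb_rational Ye) => // _ /cbasisP[i ->]; rewrite ccoordE.
move: vS; rewrite in_fsetU => /orP[|] /imfsetP[s /= sS ->].
  have [As' Qs] := S1Q s sS; case: i => [u|b]; rewrite ffunE; last first.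
    by apply: Qs; have := valP b; rewrite inE => /andP[].
  rewrite coord_proj_common ?(valP u)//.
  have /choice[q Hq] : forall b, exists q : rat, b \in D -> c b s = ratr q.
    move=> b; have [bD|bD] := boolP (b \in D); last by exists 0.
    by have [q ?] := Qs b (DCs bD); exists q.
  exists (\sum_(b <- D) q b * (val u == f b)%:R); rewrite rmorph_sum big_seq [RHS]big_seq.
  by apply: eq_bigr => b bD; rewrite Hq// rmorphM/= ratr_nat.
have [Vs' Qs] := S2Q s sS; case: i => [u|b]; rewrite ffunE; first exact: Qs (valP u).
by exists 0; rewrite rmorph0.
Qed.

(** The amalgamation property of the category of rational finite-dimensional
    K-based spaces. *)
Lemma amalgam_cospan : RI_object K (BasedData V [set` B]) ->
  RI_object K (BasedData A [set` C]) ->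
  exists (G : completeNormedModType R) (Y : based_data G) (i : F -> G) (j : E -> G),
    [/\ RI_object K Y, isometry_morphism (BasedData A [set` C]) Y i,
        isometry_morphism (BasedData V [set` B]) Y j
      & forall x, L x -> i x = j (f x)].
Proof.
move=> [_ Vr] [_ Ar].
exists (cspace amalgam), (BasedData [set: cspace amalgam] [set` cbasis amalgam]).
exists (amalgam_left : F -> cspace amalgam), (amalgam_right : E -> cspace amalgam).
split.
- by split; [exact: glue_K_based | exact: amalgam_rational].
- split=> //=; [exact: amalgam_left_linear | exact: amalgam_left_basis|].
  by move=> x Ax; rewrite cspace_normE; exact: (glue_norm1 As Vs amalgam_left_linear
    amalgam_right_linear amalgam_meet amalgam_onto).
- split=> //=; first exact: amalgam_right_linear.
    move=> b bB; apply/cbasisP; exists (inl [` bB]%fset).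
    by rewrite -[b]/(val [` bB]%fset) amalgam_right_unit.
  by move=> x Vx; rewrite cspace_normE; exact: (glue_norm2 As Vs amalgam_left_linear
    amalgam_right_linear amalgam_meet amalgam_onto).
- exact: amalgam_agree.
Qed.

End Amalgam.

(** * The completion of a Fraisse sequence *)

Section BasedSpaces.
Variables (R : realType) (K : R) (E : completeNormedModType R).

Lemma based_data_eta (X : based_data E) : X = BasedData (bspace X) (bbasis X).
Proof. by case: X. Qed.

Lemma K_based_fin_basis (X : based_data E) : K_based K X -> finite_set (bbasis X) ->
  exists (B : {fset E}) (e : E -> E -> R^o),
    X = BasedData (bspace X) [set` B] /\ fin_basis K (bspace X) B e.
Proof.
move=> [[Xs _ _] Xb] /finite_fsetP[B XB]; rewrite XB in Xb.
have [e Be] := suppression_basis_fin Xs Xb.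
by exists B, e; split=> //; rewrite -XB -based_data_eta.
Qed.

Lemma finite_dim_fin_basis (X : based_data E) : K_based K X -> finite_dim (bspace X) ->
  exists (B : {fset E}) (e : E -> E -> R^o),
    X = BasedData (bspace X) [set` B] /\ fin_basis K (bspace X) B e.
Proof.
move=> KX Xf; apply: K_based_fin_basis => //.
have [[Xs _ _] Xb] := KX; exact: suppression_basis_finite Xb.
Qed.

End BasedSpaces.

Theorem theorem4p4 (R : realType) (K : R) (hK : 1 <= K)
    (E : completeNormedModType R) (U : nat -> based_data E)
    (hU : fraisse_sequence K U) :
  [/\ K_based K (completed_union U),
      rational_based (completed_union U)
    & RI_universal K (completed_union U)].
Proof.
have K0 : 0 <= K by exact: le_trans hK.
have [chainU objU extU] := hU.
have /choice[B] : forall n, exists (B : {fset E}), exists (e : E -> E -> R^o),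
    U n = BasedData (bspace (U n)) [set` B] /\ fin_basis K (bspace (U n)) B e.
  by move=> n; have [KU [Uf _]] := objU n; exact: finite_dim_fin_basis.
move=> /choice[e UB].
have Be n : fin_basis K (bspace (U n)) (B n) (e n) by case: (UB n).
have UE n : U n = BasedData (bspace (U n)) [set` B n] by case: (UB n).
have bE n : bbasis (U n) = [set` B n] by rewrite {1}UE.
have VS n : bspace (U n) `<=` bspace (U n.+1) by have [_ []] := chainU n.
have BS n : (B n `<=` B n.+1)%fset.
  apply/fsubsetP => b bB; have [_ [_ bI]] := chainU n.
  by have : bbasis (U n) b by [rewrite bE]; rewrite bI bE => -[].
have basisE : \bigcup_n bbasis (U n) = \bigcup_n [set` B n].
  by apply: eq_bigcupr => n _; exact: bE.
have spaceW n : bspace (U n) `<=` closure (\bigcup_n bspace (U n)).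
  by move=> x Ux; apply: subset_closure; exists n.
split.
- split=> /=.
    split; [exact: closure_submod (union_submod Be VS) | exact: closed_closure |].
    by apply: completion_separable => n; have [[[]]] := chainU n.
  rewrite basisE; exact: (completion_suppression_basis K0 Be VS BS).
- move=> Z [K' _ KZ] [ZW Zb] Zf.
  have [C [c [ZE Cc]]] := finite_dim_fin_basis KZ Zf.
  have [n Cn] : exists n, (C `<=` B n)%fset.
    apply: (union_basis_fin BS) => b bC.
    have : bbasis Z b by rewrite ZE.
    by rewrite Zb /= basisE => -[].
  rewrite ZE; apply: (rational_fin_subspace (Be n) _ Cc) => //.
    by rewrite -UE; have [] := objU n.
  move=> x Zx; rewrite (fb_exp Cc Zx); apply: submod_sum; first exact: fb_submod (Be n).
  move=> b /(fsubsetP Cn) bB _; apply: submodZ; first exact: fb_submod (Be n).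
  exact: (fb_sub (Be n)).
move=> F A L f objA [K' _ KL] [LA Lb] [fl fV fb fn].
have [C [c [AE Cc]]] : exists (C : {fset F}) (c : F -> F -> R^o),
    A = BasedData (bspace A) [set` C] /\ fin_basis K (bspace A) C c.
  by have [KA [Af _]] := objA; exact: finite_dim_fin_basis.
have [D [d [LE Dd]]] : exists (D : {fset F}) (d : F -> F -> R^o),
    L = BasedData (bspace L) [set` D] /\ fin_basis K' (bspace L) D d.
  apply: K_based_fin_basis => //; rewrite Lb AE.
  by apply: (@sub_finite_set _ _ [set` C]) => [x []|].
have Db b : b \in D -> bbasis L b by rewrite LE.
have DC : (D `<=` C)%fset.
  by apply/fsubsetP => b /Db; rewrite Lb => -[_]; rewrite {1}AE.
have [n fDn] : exists n, ([fset f b | b in D] `<=` B n)%fset.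
  apply: (union_basis_fin BS) => _ /imfsetP[b /= bD ->].
  by rewrite -basisE; apply: fb; exact: Db.
have fB b : b \in D -> f b \in B n.
  by move=> bD; apply: (fsubsetP fDn); rewrite in_imfset.
have fUn x : bspace L x -> bspace (U n) (f x).
  move=> Lx; rewrite (fb_exp Dd Lx) (linear_on_sum (fb_submod Dd) fl); last first.
    by move=> b bD _; exact: (fb_sub Dd).
  apply: submod_sum; first exact: fb_submod (Be n).
  move=> b bD _; apply: submodZ; first exact: fb_submod (Be n).
  by apply: (fb_sub (Be n)); exact: fB.
have objUn : RI_object K (BasedData (bspace (U n)) [set` B n]) by rewrite -UE.
have objA' : RI_object K (BasedData (bspace A) [set` C]) by rewrite -AE.
have [G [Y [i [j [objY im jm ij]]]]] :=
  amalgam_cospan K0 (Be n) Cc Dd LA DC fl fUn fB fn objUn objA'.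
rewrite -UE in jm; rewrite -AE in im.
have [m [g [_ [gl gV gb gn] gj]]] := extU n G Y j objY jm.
have [il iV ib inm] := im.
exists (g \o i); split; last by move=> x Lx /=; rewrite ij// gj//; exact: fUn.
split=> /=.
- by move=> a x y Ax Ay /=; rewrite il// gl//; exact: iV.
- by move=> x Ax; apply: (spaceW m); apply: gV; exact: iV.
- by move=> b Ab; exists m => //; apply: gb; exact: ib.
- by move=> x Ax; rewrite gn ?inm//; exact: iV.
Qed.
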